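(* Let $A$ be a regular local ring and let $\mathfrak{D}$ be either a set of derivations of $A$ or a set of higher derivations of $A$. Let $I$ be the maximally $\mathfrak{D}$-differential ideal in $A$. Then $I$ is generated by an $A$-regular sequence, and hence $A/I$ is a complete intersection.
   Context: All rings are commutative with unity. A derivation of a ring $A$ is an additive endomorphism $d$ of $A$ such that $d(ab)=a\,d(b)+b\,d(a)$ for all $a,b\in A$. A higher derivation (Hasse--Schmidt derivation) of $A$ is an infinite sequence $D=(D_0,D_1,D_2,\dots)$ of additive endomorphisms of $A$ such that $D_0$ is the identity of $A$ and $D_n(ab)=\sum_{i+j=n}D_i(a)D_j(b)$ for all $n\ge 0$ and $a,b\in A$. For a derivation $d$ of $A$, an ideal $I$ of $A$ is $d$-differential if $d(I)\subseteq I$. For a higher derivation $D=(D_0,D_1,\dots)$ of $A$, an ideal $I$ is $D$-differential if $D_n(I)\subseteq I$ for all $n\ge 0$. For a set $\mathfrak{D}$ of derivations (or a set of higher derivations) of $A$, an ideal $I$ is $\mathfrak{D}$-differential if it is $D$-differential for all $D\in\mathfrak{D}$. An ideal $I$ is maximally $\mathfrak{D}$-differential if it is a proper $\mathfrak{D}$-differential ideal and no ideal $J$ of $A$ with $I\subsetneq J\subsetneq A$ is $\mathfrak{D}$-differential. If $A$ is local, there is a unique maximally $\mathfrak{D}$-differential ideal of $A$, and it contains all proper $\mathfrak{D}$-differential ideals of $A$. *)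

(* Defs.v *)
(* Ideals are the boolean predicates of ring_quotient, where
   [idealr A] is the type of proper ideals (of a commutative ring A) and
   [prime_idealr A] the type of its prime ideals.  With classical logic every
   subset of A is given by a boolean predicate, so no ideal is left out. *)
From HB Require Import structures.
From mathcomp Require Import all_boot all_order all_algebra.

Set Implicit Arguments.
Unset Strict Implicit.
Unset Printing Implicit Defensive.

Import GRing.Theory.
Local Open Scope ring_scope.

Definition in_gen_ideal (A : comNzRingType) (xs : seq A) (a : A) : Prop :=
  exists c : 'I_(size xs) -> A, a = \sum_(i < size xs) c i * xs`_i.

Definition generates (A : comNzRingType) (xs : seq A) (I : {pred A}) : Prop :=
  forall a : A, a \in I <-> in_gen_ideal xs a.

Definition strict_subset (T : Type) (P Q : {pred T}) : Prop :=
  {subset P <= Q} /\ exists2 x, x \in Q & x \notin P.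

(* The unit ideal, which is not an [idealr], is always generated by 1. *)
Definition noetherian (A : comNzRingType) : Prop :=
  forall J : idealr A, exists xs : seq A, generates xs J.

Definition maximal_ideal (A : comNzRingType) (M : idealr A) : Prop :=
  forall J : idealr A, ~ strict_subset M J.

Definition unique_maximal_ideal (A : comNzRingType) (M : idealr A) : Prop :=
  maximal_ideal M /\ forall N : idealr A, maximal_ideal N -> N =i M.

(* Chains P_0 < P_1 < ... < P_n, of length n, hence with n + 1 primes. *)
Definition has_prime_chain (A : comNzRingType) (n : nat) : Prop :=
  exists P : 'I_n.+1 -> prime_idealr A,
    forall i j : 'I_n.+1, (i < j)%N -> strict_subset (P i) (P j).

Definition krull_dim_eq (A : comNzRingType) (d : nat) : Prop :=
  has_prime_chain A d /\ forall n : nat, has_prime_chain A n -> (n <= d)%N.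

Definition regular_local (A : comNzRingType) : Prop :=
  noetherian A /\
  exists M : idealr A, unique_maximal_ideal M /\
    exists xs : seq A, krull_dim_eq A (size xs) /\ generates xs M.

(* xs_i is a nonzerodivisor on A / (xs_0, ..., xs_(i-1)), and A / (xs) is not
   zero. *)
Definition regular_sequence (A : comNzRingType) (xs : seq A) : Prop :=
  (forall i : nat, (i < size xs)%N -> forall a : A,
     in_gen_ideal (take i xs) (xs`_i * a) -> in_gen_ideal (take i xs) a)
  /\ ~ in_gen_ideal xs 1.

(* B is isomorphic to S / (xs) for a regular local ring S and an S-regular
   sequence xs.  No completion of B is taken: this is the stronger of the two
   usual definitions, and they agree on quotients of regular local rings. *)
Definition complete_intersection (B : comNzRingType) : Prop :=
  exists (S : comNzRingType) (xs : seq S) (f : {rmorphism S -> B}),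
    [/\ regular_local S, regular_sequence xs,
        (forall b : B, exists s : S, f s = b)
      & forall s : S, f s = 0 <-> in_gen_ideal xs s].

Record derivation (A : comNzRingType) := Derivation {
  der_fun :> {additive A -> A};
  derM : forall a b : A, der_fun (a * b) = a * der_fun b + b * der_fun a }.

Record higher_derivation (A : comNzRingType) := HigherDerivation {
  hder_fun :> nat -> {additive A -> A};
  hder0 : forall a : A, hder_fun 0%N a = a;
  hderM : forall (n : nat) (a b : A),
    hder_fun n (a * b) = \sum_(i < n.+1) hder_fun i a * hder_fun (n - i)%N b }.

Definition derivation_family (A : comNzRingType) : Type :=
  ((derivation A -> Prop) + (higher_derivation A -> Prop))%type.

Definition differential (A : comNzRingType) (DD : derivation_family A)
    (I : {pred A}) : Prop :=
  match DD with
  | inl ders => forall d : derivation A, ders d -> {in I, forall a, d a \in I}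
  | inr hders => forall D : higher_derivation A, hders D ->
                   forall n : nat, {in I, forall a, D n a \in I}
  end.

Definition maximally_differential (A : comNzRingType)
    (DD : derivation_family A) (I : idealr A) : Prop :=
  differential DD I /\
  forall J : idealr A, strict_subset I J -> ~ differential DD J.

(* Main.v *)
Require Import Defs.
From HB Require Import structures.
From mathcomp Require Import all_boot all_order all_algebra.
From mathcomp Require Import ring boolp.

Set Implicit Arguments.
Unset Strict Implicit.
Unset Printing Implicit Defensive.

(** Let [A] be regular local with maximal ideal [m], and [I] maximally
    differential.

    A minimal free resolution of [A / I] over [A] is finite, because [m] is
    generated by a regular sequence ([regular_local_gens], [regular_fres]).
    Every derivation of the family maps [I] to itself, so it lifts
    to the resolution, step by step ([hs_stable_mker]).  Hence the entries of
    each matrix of the resolution generate an ideal that becomes differential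
    after adding [I]; it lies in [m], so that it is contained in [I] by
    maximality ([maximally_differential_entries]).  In particular all relations
    between minimal generators of [I] have their coefficients in [I]: the
    conormal module of [I] is free over [A / I].

    An ideal [I] of a Noetherian local ring such that [A / I] has a finite
    resolution of this kind is generated by a regular sequence
    ([fres_regular_sequence], a variant of a theorem of Ferrand and
    Vasconcelos).  First, an element that annihilates [I] annihilates the
    matrices of the resolution, hence the last free module, so it is zero
    ([fres_faithful]).  By prime avoidance in a coset some minimal generator [a]
    of [I] is a nonzerodivisor ([coset_nzd]).  Over [A / (a)], the resolution
    of [I] becomes a resolution of [I / a I].  As the relations have their
    coefficients in [I], the map from [I / a I] onto [I / (a)] splits
    ([syzygies_split]), and direct summands inherit the hypothesis
    ([fres_summand]); so induction applies to [I / (a)] in [A / (a)].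

    That [m] is generated by a regular sequence follows from the definition of
    the dimension by chains of primes and from Krull's principal ideal theorem
    ([krull_pit]). *)

Import GRing.Theory.
Local Open Scope ring_scope.

(** * Ideals and submodules *)

Record submod (A : comNzRingType) (V : lmodType A) (S : V -> Prop) : Prop := {
  submod0 : S 0;
  submodD : forall v w, S v -> S w -> S (v + w);
  submodZ : forall a v, S v -> S (a *: v) }.

Record ideal (A : comNzRingType) (J : A -> Prop) : Prop := {
  ideal0 : J 0;
  idealD : forall a b, J a -> J b -> J (a + b);
  idealM : forall r a, J a -> J (r * a) }.

Record prime_ideal (A : comNzRingType) (P : A -> Prop) : Prop := {
  prime_idealW : ideal P;
  prime1 : ~ P 1;
  primeM : forall a b, P (a * b) -> P a \/ P b }.

Definition incl (T : Type) (S S' : T -> Prop) : Prop := forall x, S x -> S' x.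

Definition sincl (T : Type) (S S' : T -> Prop) : Prop := incl S S' /\ ~ incl S' S.

(** Linear combinations with coefficients in [C]; this is the product of [C]
    with the span of [gs] when [C] is an ideal. *)
Fixpoint cspan (A : comNzRingType) (V : lmodType A) (C : A -> Prop)
    (gs : seq V) (v : V) : Prop :=
  if gs is g :: gs' then exists c w, [/\ C c, cspan C gs' w & v = c *: g + w]
  else v = 0.

Notation lspan := (cspan (fun=> True)).
Notation rspan A := (@cspan A A^o (fun=> True)).

Definition fg (A : comNzRingType) (V : lmodType A) (S : V -> Prop) : Prop :=
  exists gs : seq V, forall v, S v <-> lspan gs v.

Definition noeth (A : comNzRingType) : Prop :=
  forall J : A -> Prop, ideal J -> @fg A A^o J.

Lemma idealMl (A : comNzRingType) (J : A -> Prop) a r :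
  ideal J -> J a -> J (a * r).
Proof. by move=> iJ Ja; rewrite mulrC; apply: idealM. Qed.

Lemma idealN (A : comNzRingType) (J : A -> Prop) a : ideal J -> J a -> J (- a).
Proof. by move=> iJ Ja; rewrite -mulN1r; apply: idealM. Qed.

Lemma idealB (A : comNzRingType) (J : A -> Prop) a b :
  ideal J -> J a -> J b -> J (a - b).
Proof. by move=> iJ Ja Jb; apply: idealD => //; apply: idealN. Qed.

Lemma idealDr (A : comNzRingType) (J : A -> Prop) a b :
  ideal J -> J a -> J (a + b) -> J b.
Proof.
by move=> iJ Ja Jab; rewrite -(addKr a b) addrC; apply: idealB.
Qed.

Lemma ideal_sum (A : comNzRingType) (J : A -> Prop) (I : Type) (r : seq I)
    (Q : pred I) (F : I -> A) :
  ideal J -> (forall i, Q i -> J (F i)) -> J (\sum_(i <- r | Q i) F i).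
Proof.
by move=> iJ JF; apply: big_ind => //; [apply: ideal0 | apply: idealD].
Qed.

Lemma submodN (A : comNzRingType) (V : lmodType A) (S : V -> Prop) v :
  submod S -> S v -> S (- v).
Proof. by move=> sS Sv; rewrite -scaleN1r; apply: submodZ. Qed.

Lemma submodB (A : comNzRingType) (V : lmodType A) (S : V -> Prop) v w :
  submod S -> S v -> S w -> S (v - w).
Proof. by move=> sS Sv Sw; apply: submodD => //; apply: submodN. Qed.

Lemma ideal_submod (A : comNzRingType) (J : A -> Prop) :
  ideal J -> @submod A A^o J.
Proof. by case=> J0 JD JM; split. Qed.

Lemma submod_ideal (A : comNzRingType) (J : A -> Prop) :
  @submod A A^o J -> ideal J.
Proof. by case=> J0 JD JM; split. Qed.

Lemma idealT (A : comNzRingType) : ideal (fun _ : A => True).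
Proof. by []. Qed.

Lemma primeM_notin (A : comNzRingType) (P : A -> Prop) a b :
  prime_ideal P -> ~ P a -> ~ P b -> ~ P (a * b).
Proof. by move=> pP Pa Pb /(primeM pP)[]. Qed.

Lemma prime_cancel (A : comNzRingType) (P : A -> Prop) a b :
  prime_ideal P -> ~ P a -> P (a * b) -> P b.
Proof. by move=> pP Pa /(primeM pP)[]. Qed.

Lemma primeX (A : comNzRingType) (P : A -> Prop) a n :
  prime_ideal P -> P (a ^+ n) -> P a.
Proof.
move=> pP; elim: n => [|n IH]; first by rewrite expr0 => /(prime1 pP).
by rewrite exprS => /(primeM pP)[].
Qed.

Lemma cspan_submod (A : comNzRingType) (V : lmodType A) (C : A -> Prop)
    (gs : seq V) : ideal C -> submod (cspan C gs).
Proof.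
move=> iC; elim: gs => [|g gs IH] /=.
  by split=> // [v w -> ->|a v ->]; rewrite ?addr0 ?scaler0.
split=> [|v w [c [v' [Cc v'P ->]]] [d [w' [Cd w'P ->]]]|a v [c [v' [Cc v'P ->]]]].
- by exists 0, 0; rewrite scale0r addr0; split=> //; [apply: ideal0|apply: submod0].
- exists (c + d), (v' + w'); split; [exact: idealD|exact: submodD|].
  by rewrite scalerDl addrACA.
- exists (a * c), (a *: v'); split; [exact: idealM|exact: submodZ|].
  by rewrite scalerDr scalerA.
Qed.

Lemma span_submod (A : comNzRingType) (V : lmodType A) (gs : seq V) :
  submod (lspan gs).
Proof. exact/cspan_submod/idealT. Qed.

Lemma cspanZ (A : comNzRingType) (V : lmodType A) (C : A -> Prop)
    (gs : seq V) c v : ideal C -> C c -> lspan gs v -> cspan C gs (c *: v).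
Proof.
move=> iC Cc; elim: gs v => [|g gs IH] v /=; first by move=> ->; rewrite scaler0.
move=> [d [w [_ wP ->]]]; exists (c * d), (c *: w).
by split; [exact: idealMl|exact: IH|rewrite scalerDr scalerA].
Qed.

Lemma cspan_min (A : comNzRingType) (V : lmodType A) (C : A -> Prop)
    (gs : seq V) (S : V -> Prop) : submod S ->
  (forall c g, C c -> g \in gs -> S (c *: g)) -> incl (cspan C gs) S.
Proof.
move=> sS; elim: gs => [|g gs IH] gsS v /=; first by move=> ->; apply: submod0.
move=> [c [w [Cc wP ->]]]; apply: submodD => //.
  by apply: gsS => //; rewrite mem_head.
by apply: IH wP => d h Cd hgs; apply: gsS => //; rewrite in_cons hgs orbT.
Qed.

Lemma span_min (A : comNzRingType) (V : lmodType A) (gs : seq V)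
    (S : V -> Prop) :
  submod S -> {in gs, forall g, S g} -> incl (lspan gs) S.
Proof. by move=> sS gsS; apply: cspan_min => // c g _ /gsS; apply: submodZ. Qed.

Lemma span_mem (A : comNzRingType) (V : lmodType A) (gs : seq V) g :
  g \in gs -> lspan gs g.
Proof.
elim: gs => // h gs IH /=; rewrite in_cons => /orP[/eqP->|/IH gP].
  by exists 1, 0; rewrite scale1r addr0; split=> //; apply: submod0 (span_submod _).
by exists 0, g; rewrite scale0r add0r.
Qed.

Lemma span_le (A : comNzRingType) (V : lmodType A) (gs hs : seq V) :
  {subset gs <= hs} -> incl (lspan gs) (lspan hs).
Proof.
by move=> gh; apply: span_min (span_submod _) _ => g /gh; apply: span_mem.
Qed.

(** Nakayama's lemma at a prime [P], without localizing: the units of the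
    local ring at [P] are replaced by multipliers outside [P].  Subtracting
    from the relation of the first generator its own contribution leaves the
    coefficient [s - p], which is still outside [P], so that this generator
    can be eliminated from all the other relations. *)
Lemma nakayama (A : comNzRingType) (V : lmodType A) (P : A -> Prop)
    (gs : seq V) (N : V -> Prop) :
  prime_ideal P -> submod N ->
  {in gs, forall g, exists s n w,
     [/\ ~ P s, N n, cspan P gs w & s *: g = n + w]} ->
  exists t, ~ P t /\ incl (lspan gs) (fun v => N (t *: v)).
Proof.
move=> pP sN; have iP := prime_idealW pP.
have sP := fun hs => cspan_submod hs iP.
suff main : {in gs, forall g, exists s n w,
     [/\ ~ P s, N n, cspan P gs w & s *: g = n + w]} ->
  exists t, ~ P t /\ {in gs, forall g, N (t *: g)}.
  move=> /main[t [Pt tN]]; exists t; split=> //; apply: span_min => //.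
  split=> [|v w Nv Nw|a v Nv]; first by rewrite scaler0; apply: submod0.
    by rewrite scalerDr; apply: submodD.
  by rewrite scalerA mulrC -scalerA; apply: submodZ.
elim: gs => [|g0 gs IH] rel; first by exists 1; split=> //; apply: prime1.
have [s0 [n0 [_ [Ps0 Nn0 [p0 [w0 [Pp0 w0P ->]]] e0]]]] := rel g0 (mem_head _ _).
pose s1 := s0 - p0; have Ps1 : ~ P s1.
  by move=> Ps1; apply: Ps0; rewrite -(subrK p0 s0); apply: idealD.
have e1 : s1 *: g0 = n0 + w0.
  by apply: (addIr (p0 *: g0)); rewrite -scalerDl subrK e0 -addrA [w0 + _]addrC.
have [|t [Pt tN]] := IH.
  move=> g ggs; have [|s [n [_ [Ps Nn [p [w [Pp wP ->]]] e]]]] := rel g.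
    by rewrite in_cons ggs orbT.
  exists (s1 * s), (s1 *: n + p *: n0), (p *: w0 + s1 *: w); split.
  - exact: primeM_notin.
  - by apply: submodD => //; apply: submodZ.
  - by apply: submodD => //; apply: submodZ.
  rewrite -scalerA e 2!scalerDr scalerA [s1 * p]mulrC -scalerA e1.
  by rewrite scalerDr !addrA.
exists (t * s1); split; first exact: primeM_notin.
move=> g; rewrite in_cons => /orP[/eqP->|ggs]; last first.
  by rewrite mulrC -scalerA; apply: submodZ => //; apply: tN.
rewrite -scalerA e1 scalerDr; apply: submodD => //; first exact: submodZ.
apply: (@cspan_min _ _ P gs (fun w => N (t *: w))) w0P; last first.
  by move=> c h _ /tN; rewrite scalerA mulrC -scalerA; apply: submodZ.
split=> [|v w Nv Nw|a v Nv]; first by rewrite scaler0; apply: submod0.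
  by rewrite scalerDr; apply: submodD.
by rewrite scalerA mulrC -scalerA; apply: submodZ.
Qed.

(** * Noetherian rings *)

Lemma noeth_chain (A : comNzRingType) (J : nat -> A -> Prop) :
  noeth A -> (forall n, ideal (J n)) -> (forall n, incl (J n) (J n.+1)) ->
  exists n, incl (J n.+1) (J n).
Proof.
move=> nA iJ Jle; have Jmono m n : (m <= n)%N -> incl (J m) (J n).
  elim: n => [|n IH]; first by rewrite leqn0 => /eqP->.
  by rewrite leq_eqVlt => /orP[/eqP->//|/IH mn] x /mn; apply: Jle.
have [|gs gsP] := nA (fun a => exists n, J n a).
  split; first by exists 0%N; apply: ideal0.
    move=> a b [m Ja] [n Jb]; exists (maxn m n); apply: idealD => //.
      by apply: Jmono Ja; rewrite leq_maxl.
    by apply: Jmono Jb; rewrite leq_maxr.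
  by move=> r a [n Ja]; exists n; apply: idealM.
have [n nP] : exists n, {in gs, forall g, J n g}.
  have: {in gs, forall g, exists n, J n g} by move=> g /span_mem/gsP.
  elim: (gs) => [|g hs IH] hsP; first by exists 0%N.
  have [|n nP] := IH; first by move=> h hhs; apply: hsP; rewrite in_cons hhs orbT.
  have [m mP] := hsP g (mem_head _ _); exists (maxn m n) => h.
  rewrite in_cons => /orP[/eqP->|/nP hn].
    by apply: Jmono mP; rewrite leq_maxl.
  by apply: Jmono hn; rewrite leq_maxr.
exists n => a Ja; apply: (@span_min A A^o gs) => //.
  exact/ideal_submod.
by apply/gsP; exists n.+1.
Qed.

Lemma noeth_max (A : comNzRingType) (F : (A -> Prop) -> Prop) :
  noeth A -> (forall J, F J -> ideal J) -> (exists J, F J) ->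
  exists2 J, F J & forall K, F K -> incl J K -> incl K J.
Proof.
move=> nA Fi [J0 FJ0]; apply: contrapT => nomax.
have step (J : {J | F J}) : exists K : {J | F J},
    incl (projT1 J) (projT1 K) /\ ~ incl (projT1 K) (projT1 J).
  apply: contrapT => nK; apply: nomax; exists (projT1 J); first exact: projT2 J.
  move=> K FK JK; apply: contrapT => nKJ; apply: nK.
  by exists (exist _ K FK).
have [f fP] := choice step.
pose J n := projT1 (iter n f (exist _ J0 FJ0)).
have [n||n] := @noeth_chain A J nA.
- by apply: Fi; apply: (projT2 (iter n f _)).
- by move=> n; apply: (proj1 (fP _)).
- exact: (proj2 (fP (iter n f _))).
Qed.

Lemma noeth_fin_gen (A : comNzRingType) (G : A -> Prop) :
  noeth A -> exists gs : seq A,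
    {in gs, forall g, G g} /\ forall g, G g -> rspan A gs g.
Proof.
move=> nA.
have [||K [gs [gsG eK]] Kmax] := @noeth_max A
  (fun K => exists gs : seq A, {in gs, forall g, G g} /\ K = rspan A gs) nA.
- by move=> _ [gs [_ ->]]; apply/submod_ideal/span_submod.
- by exists (rspan A [::]), [::].
exists gs; split=> // g Gg; rewrite -eK.
apply: (Kmax (rspan A (g :: gs))); rewrite ?eK.
- exists (g :: gs); split=> // h.
  by rewrite in_cons => /orP[/eqP->//|/gsG].
- by apply: (@span_le A A^o) => h hgs; rewrite in_cons hgs orbT.
- by apply: (@span_mem A A^o); rewrite mem_head.
Qed.

(** Passing from [g] to a multiple [a * g] outside [L] enlarges the colon ideal
    [(L : g)], hence does not change it when it is maximal: this is primality.
    The maximality is part of the conclusion because it makes primes of this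
    form incomparable, which prime avoidance uses. *)
Lemma colon_prime (A : comNzRingType) (L : A -> Prop) (h : A) :
  noeth A -> ideal L -> ~ L h ->
  exists g, [/\ ~ L g, prime_ideal (fun a => L (a * g)),
    incl (fun a => L (a * h)) (fun a => L (a * g)) &
    forall g', ~ L g' -> incl (fun a => L (a * g)) (fun a => L (a * g')) ->
      incl (fun a => L (a * g')) (fun a => L (a * g))].
Proof.
move=> nA iL Lh.
have ic g : ideal (fun a => L (a * g)).
  split; first by rewrite mul0r; apply: ideal0.
    by move=> a b La Lb; rewrite mulrDl; apply: idealD.
  by move=> r a La; rewrite -mulrA; apply: idealM.
have [||K [g [Lg hg eK]] Kmax] := @noeth_max A (fun K => exists g,
    [/\ ~ L g, incl (fun a => L (a * h)) (fun a => L (a * g)) &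
     K = fun a => L (a * g)]) nA.
- by move=> _ [g [_ _ ->]].
- by exists (fun a => L (a * h)), h; split.
have gmax g' : ~ L g' -> incl (fun a => L (a * g)) (fun a => L (a * g')) ->
      incl (fun a => L (a * g')) (fun a => L (a * g)).
  move=> Lg' le; rewrite -eK; apply: Kmax; last by rewrite eK.
  by exists g'; split=> // a /hg/le.
exists g; split=> //; split=> //; first by rewrite mul1r.
move=> a b Lab; have [La|La] := pselect (L (a * g)); [by left|right].
apply: gmax La _ _ _.
  by move=> c Lc; rewrite mulrCA; apply: idealM.
by rewrite mulrA [b * a]mulrC.
Qed.
(** * Krull's principal ideal theorem *)

Definition saturated (A : comNzRingType) (P J : A -> Prop) : Prop :=
  forall s a, ~ P s -> J (s * a) -> J a.

(** If no prime lies strictly between [B] and [P], then the localization at [P]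
    of the quotient by [B] is Artinian.  The ideals [L] in whose trace the
    sequence becomes stationary have a maximal element, and it cannot be
    proper: an associated prime of [L] lies between [B] and [P], so it is [P],
    and the corresponding element [g] enlarges [L] by a simple module. *)
Lemma saturated_dcc (A : comNzRingType) (P B : A -> Prop)
    (J : nat -> A -> Prop) :
  noeth A -> prime_ideal P -> ideal B -> incl B P ->
  (forall Q, prime_ideal Q -> incl B Q -> incl Q P -> incl P Q) ->
  (forall n, ideal (J n)) -> (forall n, saturated P (J n)) ->
  (forall n, incl B (J n)) -> (forall n, incl (J n.+1) (J n)) ->
  exists n, incl (J n) (J n.+1).
Proof.
move=> nA pP iB BP Bmin iJ satJ BJ Jdecr.
have Jle m n : (m <= n)%N -> incl (J n) (J m).
  elim: n => [|n IH]; first by rewrite leqn0 => /eqP->.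
  by rewrite leq_eqVlt => /orP[/eqP->//|/IH mn] x /Jdecr/mn.
pose stat (L : A -> Prop) n0 :=
  forall n, (n0 <= n)%N -> forall a, L a -> J n a -> J n.+1 a.
have [||L [iL satL BL [n0 Ln0]] Lmax] := @noeth_max A (fun L =>
    [/\ ideal L, saturated P L, incl B L & exists n0, stat L n0]) nA.
- by move=> L [].
- exists (fun a => exists2 s, ~ P s & B (s * a)); split.
  + split; first by exists 1; [exact: prime1|rewrite mulr0; apply: ideal0].
      move=> a b [s Ps Ba] [t Pt Bb]; exists (s * t); first exact: primeM_notin.
      rewrite mulrDr; apply: idealD => //; last by rewrite -mulrA; apply: idealM.
      by rewrite mulrAC; apply: idealMl.
    by move=> r a [s Ps Ba]; exists s => //; rewrite mulrCA; apply: idealM.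
  + move=> s a Ps [t Pt Ba]; exists (t * s); first exact: primeM_notin.
    by rewrite -mulrA.
  + by move=> a Ba; exists 1; [exact: prime1|rewrite mul1r].
  + by exists 0%N => n _ a [s Ps Ba] _; apply: (satJ n.+1 s) => //; apply: BJ.
have [L1|L1] := pselect (L 1).
  exists n0 => a; apply: Ln0 => //.
  by rewrite -[a]mulr1; apply: idealM.
have [g [Lg pLg _ _]] := colon_prime nA iL L1.
have PLg : incl P (fun a => L (a * g)).
  apply: Bmin => // [a /BL La|a Lag]; first exact: idealMl.
  by apply: contrapT => Pa; apply: Lg; apply: (satL a).
pose L' a := exists s b, ~ P s /\ L (s * a - b * g).
have L'g : L' g.
  by exists 1, 1; rewrite subrr; split; [exact: prime1|apply: ideal0].
have LL' : incl L L'.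
  move=> a La; exists 1, 0; split; first exact: prime1.
  by rewrite mul0r subr0 mul1r.
case: Lg; apply: (Lmax L') => //; split.
- split; first by apply: LL'; apply: ideal0.
    move=> a b [s [c [Ps La]]] [t [d [Pt Lb]]].
    exists (s * t), (t * c + s * d); split; first exact: primeM_notin.
    have -> : s * t * (a + b) - (t * c + s * d) * g =
      t * (s * a - c * g) + s * (t * b - d * g) by ring.
    by apply: idealD => //; apply: idealM.
  move=> r a [s [c [Ps La]]]; exists s, (r * c); split=> //.
  have -> : s * (r * a) - r * c * g = r * (s * a - c * g) by ring.
  exact: idealM.
- move=> s a Ps [t [c [Pt La]]]; exists (t * s), c; rewrite -mulrA.
  by split=> //; exact: primeM_notin.
- by move=> a /BL/LL'.
have [[n1 n1P]|new] := pselect (exists n1, forall a, L' a -> J n1 a -> L a).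
  exists (maxn n0 n1) => n; rewrite geq_max => /andP[n0n n1n] a L'a Jna.
  by apply: Ln0 => //; apply: n1P => //; apply: Jle Jna.
exists n0 => n n0n a [s [b [Ps Lab]]] Jna.
(* An element of [J n.+1] with a leading coefficient [d] outside [P] serves to
   cancel the leading coefficient of [a]. *)
have [a' [[t [d [Pt La'd]]] Ja' La']] :
    exists a', [/\ L' a', J n.+1 a' & ~ L a'].
  apply: contrapT => no; apply: new; exists n.+1 => a' L'a' Ja'.
  by apply: contrapT => La'; apply: no; exists a'.
have Pd : ~ P d.
  move=> /PLg Ldg; apply: La'; apply: (satL t) => //.
  by rewrite -(subrK (d * g) (t * a')); apply: idealD.
apply: (satJ n.+1 (d * s)); first exact: primeM_notin.
have -> : d * s * a = b * t * a' + (d * s * a - b * t * a') by ring.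
have Jbt m : J n.+1 (m * a') by apply: idealM.
apply: idealD => //; apply: Ln0 => //.
  have -> : d * s * a - b * t * a' = d * (s * a - b * g) - b * (t * a' - d * g).
    by ring.
  by apply: idealB => //; apply: idealM.
by apply: idealB => //; [apply: idealM|apply: Jdecr].
Qed.

(** The ideal [Q ^ n + P0], as the intersection of all ideals that contain the
    required elements. *)
Fixpoint power_mod (A : comNzRingType) (P0 Q : A -> Prop) (n : nat) : A -> Prop :=
  if n is n'.+1 then fun a => forall K, ideal K -> incl P0 K ->
    (forall q b, Q q -> power_mod P0 Q n' b -> K (q * b)) -> K a
  else fun=> True.

Lemma power_mod_ideal (A : comNzRingType) (P0 Q : A -> Prop) n :
  ideal (power_mod P0 Q n).
Proof.
case: n => [|n] //=; split=> [K iK _ _|a b Pa Pb K iK K0 KQ|r a Pa K iK K0 KQ].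
- exact: ideal0.
- by apply: idealD => //; [apply: Pa|apply: Pb].
- by apply: idealM => //; apply: Pa.
Qed.

Lemma power_mod_base (A : comNzRingType) (P0 Q : A -> Prop) n :
  incl P0 (power_mod P0 Q n).
Proof. by case: n => //= n a P0a K _ K0 _; apply: K0. Qed.

Lemma power_mod_le (A : comNzRingType) (P0 Q : A -> Prop) n :
  incl (power_mod P0 Q n.+1) (power_mod P0 Q n).
Proof.
move=> a; apply; first exact: power_mod_ideal.
  exact: power_mod_base.
by move=> q b _; apply: idealM; apply: power_mod_ideal.
Qed.

Lemma power_modX (A : comNzRingType) (P0 Q : A -> Prop) n q :
  Q q -> power_mod P0 Q n (q ^+ n).
Proof.
by move=> Qq; elim: n => //= n IH K _ _ KQ; rewrite exprS; apply: KQ.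
Qed.

(** The [Q]-primary component of [Q ^ n + P0]: modulo [P0], the [n]-th symbolic
    power of [Q]. *)
Definition symb (A : comNzRingType) (P0 Q : A -> Prop) n (a : A) : Prop :=
  exists2 s, ~ Q s & power_mod P0 Q n (s * a).

Lemma symb_ideal (A : comNzRingType) (P0 Q : A -> Prop) n :
  prime_ideal Q -> ideal (symb P0 Q n).
Proof.
move=> pQ; have iQ := power_mod_ideal P0 Q n.
split; first by exists 1; [exact: prime1|rewrite mulr0; apply: ideal0].
  move=> a b [s Qs sa] [t Qt tb]; exists (s * t); first exact: primeM_notin.
  rewrite mulrDr; apply: idealD => //; last by rewrite -mulrA; apply: idealM.
  by rewrite mulrAC; apply: idealMl.
by move=> r a [s Qs sa]; exists s => //; rewrite mulrCA; apply: idealM.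
Qed.

Lemma symb_sat (A : comNzRingType) (P0 Q : A -> Prop) n :
  prime_ideal Q -> saturated Q (symb P0 Q n).
Proof.
move=> pQ s a Qs [t Qt sa]; exists (t * s); first exact: primeM_notin.
by rewrite -mulrA.
Qed.

(** Nakayama's lemma at [Q]: if the symbolic powers of [Q] become stationary,
    then [Q] is minimal over [P0]. *)
Lemma symb_strict (A : comNzRingType) (P0 Q : A -> Prop) n :
  noeth A -> prime_ideal P0 -> prime_ideal Q -> sincl P0 Q ->
  ~ incl (symb P0 Q n) (symb P0 Q n.+1).
Proof.
move=> nA pP0 pQ [P0Q QP0] stat; apply: QP0 => q Qq.
apply: (primeX (n := n) pP0).
have [gs gsP] := nA _ (power_mod_ideal P0 Q n).
have iQ := prime_idealW pQ; have iP0 := prime_idealW pP0.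
have [|t [Qt tP0]] := @nakayama A A^o Q gs P0 pQ (ideal_submod iP0).
  move=> g /(@span_mem _ A^o)/gsP gP; have [|s Qs sg] := stat g.
    by exists 1; [exact: prime1|rewrite mul1r].
  pose K a := exists m w, [/\ P0 m, @cspan A A^o Q gs w & a = m + w].
  suff [n0 [w [P0n wP e]]] : K (s * g) by exists s, n0, w.
  have sQ := @cspan_submod A A^o Q gs iQ.
  apply: (sg K) => [|a P0a|p b Qp bP].
  - split; first by exists 0, 0; split; [apply: ideal0|apply: submod0|rewrite addr0].
      move=> _ _ [m [w [Pm wP ->]]] [m' [w' [Pm' wP' ->]]].
      exists (m + m'), (w + w'); rewrite addrACA.
      by split=> //; [apply: idealD|apply: submodD].
    move=> r _ [m [w [Pm wP ->]]]; exists (r * m), (r * w); rewrite mulrDr.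
    by split=> //; [apply: idealM|apply: (submodZ sQ)].
  - by exists a, 0; rewrite addr0; split=> //; apply: submod0.
  - exists 0, (p * b); rewrite add0r; split=> //; first exact: ideal0.
    by apply: (@cspanZ A A^o) => //; apply/gsP.
apply: (@prime_cancel A P0 t) => // [/P0Q//|].
by apply: tP0; apply/gsP; apply: power_modX.
Qed.

Definition adjoin (A : comNzRingType) (J : A -> Prop) (x : A) (a : A) : Prop :=
  exists m r, J m /\ a = m + r * x.

Lemma adjoin_incl (A : comNzRingType) (J : A -> Prop) x : incl J (adjoin J x).
Proof. by move=> m Jm; exists m, 0; rewrite mul0r addr0. Qed.

Lemma adjoin_mem (A : comNzRingType) (J : A -> Prop) x : ideal J -> adjoin J x x.
Proof. by move=> iJ; exists 0, 1; rewrite mul1r add0r; split=> //; apply: ideal0. Qed.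

Lemma adjoin_ideal (A : comNzRingType) (J : A -> Prop) x :
  ideal J -> ideal (adjoin J x).
Proof.
move=> iJ; split; first by apply: adjoin_incl; apply: ideal0.
  move=> _ _ [m [r [Jm ->]]] [m' [r' [Jm' ->]]]; exists (m + m'), (r + r').
  by rewrite mulrDl addrACA; split=> //; apply: idealD.
move=> c _ [m [r [Jm ->]]]; exists (c * m), (c * r).
by rewrite mulrDr mulrA; split=> //; apply: idealM.
Qed.

Lemma adjoin_min (A : comNzRingType) (J K : A -> Prop) x :
  ideal K -> incl J K -> K x -> incl (adjoin J x) K.
Proof.
by move=> iK JK Kx _ [m [r [Jm ->]]]; apply: idealD (JK _ Jm) (idealM iK r Kx).
Qed.

(** Krull's principal ideal theorem, as a statement on chains.  If no prime
    [P] as required exists, then [P2] is minimal over [P0 + (x)].  Then by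
    [saturated_dcc] the symbolic powers of [P1] become stationary modulo
    [x], hence become stationary by Nakayama at [P2]. *)
Lemma krull_pit (A : comNzRingType) (P0 P1 P2 : A -> Prop) (x : A) :
  noeth A -> prime_ideal P0 -> prime_ideal P1 -> prime_ideal P2 ->
  sincl P0 P1 -> sincl P1 P2 -> P2 x ->
  exists P, [/\ prime_ideal P, sincl P0 P, sincl P P2 & P x].
Proof.
move=> nA pP0 pP1 pP2 P01 P12 P2x.
have [P1x|P1x] := pselect (P1 x); first by exists P1.
apply: contrapT => noP.
have [[P0P1 P1P0] [P1P2 P2P1]] := (P01, P12).
have iP0 := prime_idealW pP0; have iP2 := prime_idealW pP2.
pose B := adjoin P0 x.
have BP0 : incl P0 B := adjoin_incl x.
have Bx : B x by apply: adjoin_mem.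
have iB : ideal B by apply: adjoin_ideal.
pose S n := symb P0 P1 n; have iS n : ideal (S n) := symb_ideal P0 n pP1.
have S0 n : incl P0 (S n).
  by move=> a P0a; exists 1; [exact: prime1|rewrite mul1r; apply: power_mod_base].
have Sle n : incl (S n.+1) (S n).
  by move=> a [s Ps sa]; exists s => //; apply: power_mod_le.
pose J n a := exists s q r, [/\ ~ P2 s, S n q & s * a = q + r * x].
have [||||||n Jn] := @saturated_dcc A P2 B J nA pP2 iB.
- by apply: adjoin_min => // m /P0P1/P1P2.
- move=> P pP BP PP2; apply: contrapT => P2P; apply: noP.
  exists P; split=> //; last exact: BP.
  split; first by move=> a /BP0/BP.
  by move=> PP0; apply: P1x; apply: P0P1; apply: PP0; apply: BP.
- move=> n; split.
  + exists 1, 0, 0; rewrite mulr0 mul0r addr0.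
    by split=> //; [exact: prime1|apply: ideal0].
  + move=> a b [s [q [r [Ps Sq e]]]] [s' [q' [r' [Ps' Sq' e']]]].
    exists (s * s'), (s' * q + s * q'), (s' * r + s * r'); split.
    * exact: primeM_notin.
    * by apply: idealD => //; apply: idealM.
    have -> : s * s' * (a + b) = s' * (s * a) + s * (s' * b) by ring.
    by rewrite e e'; ring.
  + move=> c a [s [q [r [Ps Sq e]]]]; exists s, (c * q), (c * r).
    by split=> //; [apply: idealM|rewrite mulrCA e; ring].
- move=> n s a Ps [t [q [r [Pt Sq e]]]]; exists (t * s), q, r.
  by rewrite -mulrA; split=> //; apply: primeM_notin.
- move=> n _ [m [r [Pm ->]]]; exists 1, m, r.
  by rewrite mul1r; split=> //; [exact: prime1|apply: S0].
- by move=> n a [s [q [r [Ps Sq e]]]]; exists s, q, r; split=> //; apply: Sle.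
apply: (@symb_strict A P0 P1 n) => // a.
have [gs gsP] := nA _ (iS n).
have [|t [P2t tS]] := @nakayama A A^o P2 gs (S n.+1) pP2 (ideal_submod (iS _)).
  move=> g /(@span_mem _ A^o)/gsP Sg.
  have [|s [q [r [Ps Sq e]]]] := Jn g.
    by exists 1, g, 0; rewrite mul1r mul0r addr0; split=> //; exact: prime1.
  have Sr : S n r.
    apply: (symb_sat pP1 P1x); rewrite mulrC; apply: (idealDr (iS n) (Sle _ _ Sq)).
    by rewrite -e; apply: idealM.
  exists s, q, (r * x); split=> //; rewrite mulrC.
  by apply: (@cspanZ A A^o) => //; apply/gsP.
move=> /gsP/tS Sta; apply: (symb_sat (s := t) pP1) => //.
by move=> /P1P2.
Qed.

Definition prime_chain (A : comNzRingType) (n : nat) (P : nat -> A -> Prop) :=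
  (forall i, (i <= n)%N -> prime_ideal (P i)) /\
  forall i, (i < n)%N -> sincl (P i) (P i.+1).

(** Dividing by [x] lowers the length of a chain by at most one: the principal
    ideal theorem pushes the membership of [x] down the chain, one prime at a
    time, from the last prime to the second one. *)
Lemma prime_chain_through (A : comNzRingType) n (P : nat -> A -> Prop) (x : A) :
  noeth A -> prime_chain n.+1 P -> P n.+1 x ->
  exists Q, [/\ prime_chain n Q, incl (P 0) (Q 0), Q 0 x & incl (Q n) (P n.+1)].
Proof.
move=> nA; elim: n P => [|n IH] P [pP ltP] Px.
  exists (fun=> P 1%N); split=> //; last by apply: (proj1 (ltP 0%N isT)).
  by split=> // i _; apply: pP.
have [||||||P' [pP' P'l P'r P'x]] := @krull_pit A (P n) (P n.+1) (P n.+2) x nA.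
- by apply: pP; rewrite !leqW.
- by apply: pP; rewrite leqW.
- exact: pP.
- by apply: ltP; rewrite leqW.
- exact: ltP.
- exact: Px.
pose P'' i := if (i <= n)%N then P i else P'.
have [||Q [[pQ ltQ] Q0 Qx Qn]] := IH P''.
- split=> [i _|i]; rewrite /P''.
    by case: ifP => // lin; apply: pP; rewrite leqW // leqW.
  rewrite ltnS => lin; rewrite lin; case: ltnP => [lt|ge].
    by apply: ltP; rewrite ltnS leqW.
  by rewrite (_ : i = n) //; apply/eqP; rewrite eqn_leq lin.
- by rewrite /P'' ltnn.
rewrite /P'' ltnn /= in Q0 Qn.
exists (fun i => if (i <= n)%N then Q i else P n.+2); rewrite ltnn; split=> //.
split=> [i _|i]; first by case: ifP => [/pQ//|_]; apply: pP.
rewrite ltnS => lin; rewrite lin; case: ltnP => [lt|ge]; first exact: ltQ.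
have -> : i = n by apply/eqP; rewrite eqn_leq lin.
have [P'P2 P2P'] := P'r.
by split=> [a /Qn/P'P2//|le]; apply: P2P' => a /le/Qn.
Qed.
(** * Local rings and quotient rings *)

(** When [A] is local this is its maximal ideal, and a surjection between local
    rings maps one to the other ([quot_nonunit]). *)
Definition nonunit (A : comNzRingType) (a : A) : Prop := forall b, b * a <> 1.

Definition local (A : comNzRingType) : Prop :=
  forall a b : A, nonunit a -> nonunit b -> nonunit (a + b).

Lemma unit_ex (A : comNzRingType) (a : A) : ~ nonunit a -> exists b, b * a = 1.
Proof.
by move=> na; apply: contrapT => nb; apply: na => b ab; apply: nb; exists b.
Qed.

Lemma nonunit_prime (A : comNzRingType) : local A -> prime_ideal (@nonunit A).
Proof.
move=> lA; split; first split=> //.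
- by move=> b; rewrite mulr0 => /esym/eqP; rewrite oner_eq0.
- by move=> r a na b; rewrite mulrA; apply: na.
- by move=> /(_ 1); rewrite mulr1.
move=> a b nab; apply: contrapT => /not_orP[/unit_ex[c ca] /unit_ex[d db]].
by apply: (nab (d * c)); rewrite mulrA -[d * c * a]mulrA ca mulr1.
Qed.

Lemma nonunit_ideal (A : comNzRingType) : local A -> ideal (@nonunit A).
Proof. by move=> lA; apply: prime_idealW; apply: nonunit_prime. Qed.

Lemma proper_nonunit (A : comNzRingType) (J : A -> Prop) :
  ideal J -> ~ J 1 -> incl J (@nonunit A).
Proof. by move=> iJ J1 a Ja b ba; apply: J1; rewrite -ba; apply: idealM. Qed.

Lemma nakayama_local (A : comNzRingType) (V : lmodType A) (gs : seq V)
    (N : V -> Prop) :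
  local A -> submod N ->
  {in gs, forall g, exists n w, [/\ N n, cspan (@nonunit A) gs w & g = n + w]} ->
  incl (lspan gs) N.
Proof.
move=> lA sN gsN.
have [|t [/unit_ex[u ut] tN]] := nakayama (gs := gs) (nonunit_prime lA) sN.
  move=> g /gsN[n [w [Nn wP e]]]; exists 1, n, w.
  by rewrite scale1r; split=> //; apply: (prime1 (nonunit_prime lA)).
by move=> v /tN/(submodZ sN u); rewrite scalerA ut scale1r.
Qed.

(** Quotient rings enter only through this characterization, which makes
    iterated quotients as easy to handle as a single one. *)
Definition is_quot (A B : comNzRingType) (f : {rmorphism A -> B})
    (J : A -> Prop) : Prop :=
  (forall b, exists a, f a = b) /\ forall a, f a = 0 <-> J a.

Lemma idealr_ex (A : comNzRingType) (J : A -> Prop) :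
  ideal J -> ~ J 1 -> exists I : idealr A, forall a, a \in I <-> J a.
Proof.
move=> iJ J1; pose S (a : A) := `[<J a>].
have cS : idealr_closed S.
  split; first by apply/asboolP; apply: ideal0.
    by apply/negP=> /asboolP.
  move=> a u v /asboolP Ju /asboolP Jv; apply/asboolP.
  by apply: idealD => //; apply: idealM.
pose I : idealr A := HB.pack S (isIdealr.Build A S cS).
by exists I => a; rewrite [a \in I]/(S a); split=> /asboolP.
Qed.

Lemma quot_ex (A : comNzRingType) (J : A -> Prop) :
  ideal J -> ~ J 1 ->
  exists (B : comNzRingType) (f : {rmorphism A -> B}), is_quot f J.
Proof.
move=> iJ J1; have [I IJ] := idealr_ex iJ J1.
exists {ideal_quot I}, (\pi_{ideal_quot I})%qT; split.
  by move=> b; exists (repr b); apply: reprK.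
move=> a; rewrite -IJ -(rmorph0 (\pi_{ideal_quot I})%qT) -[a in a \in I]subr0.
rewrite Quotient.idealrBE; split; [by move=> /eqP|by move=> /eqP].
Qed.

Lemma rspan_quot (A B : comNzRingType) (f : {rmorphism A -> B}) (gs : seq A) b :
  (forall b, exists a, f a = b) ->
  rspan B (map f gs) b <-> exists2 a, rspan A gs a & f a = b.
Proof.
move=> fs; elim: gs b => [|g gs IH] b /=.
  by split=> [->|[_ -> <-]]; [exists 0; rewrite ?rmorph0|rewrite rmorph0].
split=> [[c [w [_ /IH[a aP <-] ->]]]|[_ [c [w [_ wP ->]]] <-]].
  have [c' <-] := fs c; exists (c' *: (g : A^o) + a); first by exists c', a.
  by rewrite rmorphD rmorphM.
exists (f c), (f w); split=> //; last by rewrite rmorphD rmorphM.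
by apply/IH; exists w.
Qed.

Lemma quot_noeth (A B : comNzRingType) (f : {rmorphism A -> B}) J :
  is_quot f J -> noeth A -> noeth B.
Proof.
move=> [fs _] nA K iK; have [|gs gsP] := nA (fun a => K (f a)).
  split=> [|a b Ka Kb|r a Ka]; rewrite ?rmorph0 ?rmorphD ?rmorphM.
  - exact: ideal0.
  - exact: idealD.
  - exact: idealM.
exists (map f gs) => b; rewrite rspan_quot //.
split=> [|[a /gsP Ka <-//]]; have [a <-] := fs b => Ka.
by exists a => //; apply/gsP.
Qed.

Lemma quot_nonunit (A B : comNzRingType) (f : {rmorphism A -> B}) J :
  is_quot f J -> local A -> incl J (@nonunit A) ->
  forall a, nonunit (f a) <-> nonunit a.
Proof.
move=> [fs fK] lA Jm a; split=> na b.
  by move=> ba; apply: (na (f b)); rewrite -rmorphM ba rmorph1.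
have [c <-] := fs b; rewrite -rmorphM => /eqP.
rewrite -subr_eq0 -(rmorph1 f) -rmorphB => /eqP/fK/Jm ca1.
have iA := nonunit_ideal lA; apply: (prime1 (nonunit_prime lA)).
by rewrite -(subKr (c * a) 1); apply: (idealB iA) => //; exact: (idealM iA).
Qed.

Lemma quot_local (A B : comNzRingType) (f : {rmorphism A -> B}) J :
  is_quot f J -> local A -> incl J (@nonunit A) -> local B.
Proof.
move=> fq lA Jm a b; have [fs _] := fq.
have [a' <-] := fs a; have [b' <-] := fs b; rewrite -rmorphD.
by rewrite !(quot_nonunit fq) //; apply: lA.
Qed.

Definition img (T U : Type) (f : T -> U) (S : T -> Prop) (u : U) : Prop :=
  exists2 x, S x & f x = u.

Lemma quot_img (A B : comNzRingType) (f : {rmorphism A -> B}) J P a :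
  is_quot f J -> ideal P -> incl J P -> img f P (f a) <-> P a.
Proof.
move=> [_ fK] iP JP; split=> [[b Pb fab]|Pa]; last by exists a.
rewrite -(subrK b a); apply: idealD => //; apply: JP; apply/fK.
by rewrite rmorphB fab subrr.
Qed.

Lemma quot_ideal (A B : comNzRingType) (f : {rmorphism A -> B}) J P :
  is_quot f J -> ideal P -> ideal (img f P).
Proof.
move=> [fs _] iP; split; first by exists 0; [apply: ideal0|rewrite rmorph0].
  move=> _ _ [a Pa <-] [b Pb <-]; rewrite -rmorphD.
  by exists (a + b) => //; apply: idealD.
move=> r _ [a Pa <-]; have [c <-] := fs r; rewrite -rmorphM.
by exists (c * a) => //; apply: idealM.
Qed.

Lemma quot_chain (A B : comNzRingType) (f : {rmorphism A -> B}) J n P :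
  is_quot f J -> prime_chain n P -> incl J (P 0) ->
  prime_chain n (fun i => img f (P i)).
Proof.
move=> fq [pP ltP] JP0; have [fs _] := fq.
have JP i : (i <= n)%N -> incl J (P i).
  elim: i => // i IH lin a Ja; apply: (proj1 (ltP i lin)).
  by apply: IH Ja; apply: ltnW.
have iE i (lin : (i <= n)%N) a :=
  quot_img a fq (prime_idealW (pP i lin)) (JP i lin).
split=> i lin.
  have pPi := pP i lin; split; first exact: quot_ideal fq (prime_idealW pPi).
    by rewrite -(rmorph1 f) iE //; apply: prime1.
  move=> a b; have [a' <-] := fs a; have [b' <-] := fs b; rewrite -rmorphM.
  by rewrite !iE //; apply: primeM.
have [le nle] := ltP i lin; split; first by move=> _ [a /le Pa <-]; exists a.
move=> le'; apply: nle => a Pa; apply/(iE i (ltnW lin)).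
by apply: le'; exists a.
Qed.

(** * Regular sequences *)

(** Weak regularity of [xs] on the quotient by [J].  The recursion absorbs the
    elements into [J] from the left, which fits inductions that divide by the
    first element. *)
Fixpoint regmod (A : comNzRingType) (J : A -> Prop) (xs : seq A) : Prop :=
  if xs is x :: xs' then
    (forall a, J (x * a) -> J a) /\ regmod (adjoin J x) xs'
  else True.

Definition zero_ideal (A : comNzRingType) (a : A) : Prop := a = 0.

Lemma zero_ideal_ideal (A : comNzRingType) : ideal (@zero_ideal A).
Proof.
by split=> // [a b -> ->|r a ->]; rewrite /zero_ideal ?addr0 ?mulr0.
Qed.

Lemma incl_ext (T : Type) (S S' : T -> Prop) : (forall x, S x <-> S' x) -> S = S'.
Proof. by move=> e; apply: funext => x; apply: propext. Qed.

Lemma regmod_preim (A B : comNzRingType) (f : {rmorphism A -> B}) K xs :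
  (forall b, exists a, f a = b) ->
  regmod K (map f xs) <-> regmod (fun a => K (f a)) xs.
Proof.
move=> fs; elim: xs K => //= x xs IH K.
have <- : (fun a => adjoin K (f x) (f a)) = adjoin (fun a => K (f a)) x.
  apply: incl_ext => a; split=> [[m [r [Km e]]]|[m [r [Km ->]]]]; last first.
    by exists (f m), (f r); rewrite rmorphD rmorphM.
  have [r' er] := fs r; exists (a - r' * x), r'; rewrite subrK.
  by rewrite rmorphB e rmorphM er addrK.
rewrite IH; split=> [[xK ?]|[xK ?]]; split=> // a.
  by rewrite rmorphM; apply: xK.
by have [a' <-] := fs a; rewrite -rmorphM; apply: xK.
Qed.

Lemma regmod_quot (A B : comNzRingType) (f : {rmorphism A -> B}) J xs :
  is_quot f J -> regmod (@zero_ideal B) (map f xs) <-> regmod J xs.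
Proof.
move=> [fs fK]; rewrite (regmod_preim _ _ fs).
by rewrite (_ : (fun a => _) = J) //; apply: incl_ext.
Qed.

Lemma in_gen_idealE (A : comNzRingType) (xs : seq A) a :
  in_gen_ideal xs a <-> rspan A xs a.
Proof.
elim: xs a => [|x xs IH] a /=.
  split=> [[c ->]|->]; first by rewrite big_ord0.
  by exists (fun=> 0); rewrite big_ord0.
split=> [[c ->]|[c [w [_ /IH[d ->] ->]]]].
  rewrite big_ord_recl /=; exists (c ord0).
  exists (\sum_(i < size xs) c (lift ord0 i) * xs`_i); split=> //.
  by apply/IH; exists (fun i => c (lift ord0 i)).
exists (fun i => oapp d c (unlift ord0 i)).
rewrite big_ord_recl unlift_none /=; congr (_ + _).
by apply: eq_bigr => i _; rewrite liftK.
Qed.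

Lemma regmod_nth (A : comNzRingType) (J : A -> Prop) (xs : seq A) i a :
  regmod J xs -> (i < size xs)%N ->
  (exists m w, [/\ J m, rspan A (take i xs) w & xs`_i * a = m + w]) ->
  exists m w, [/\ J m, rspan A (take i xs) w & a = m + w].
Proof.
elim: xs J i => // x xs IH J [|i] [xJ xsJ] /=.
  move=> _ [m [_ [Jm -> e]]]; exists a, 0; rewrite addr0; split=> //.
  by apply: xJ; rewrite e addr0.
rewrite ltnS => ilt [m [_ [Jm [c [w [_ wP ->]]] e]]].
have [|_ [w' [[m' [r [Jm' ->]]] w'P ->]]] := IH _ _ xsJ ilt.
  exists (m + c * x), w; split=> //; first by exists m, c.
  by rewrite e addrA.
exists m', (r * x + w'); rewrite addrA; split=> //.
by exists r, w'.
Qed.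

Lemma regmod_regular (A : comNzRingType) (xs : seq A) :
  regmod (@zero_ideal A) xs -> ~ rspan A xs 1 -> regular_sequence xs.
Proof.
move=> xsr xs1; split; last by rewrite in_gen_idealE.
move=> i ilt a; rewrite !in_gen_idealE => xaP.
have [|m [w [-> wP ->]]] := regmod_nth (a := a) xsr ilt; last by rewrite add0r.
by exists 0, (xs`_i * a); rewrite add0r.
Qed.

Definition prodI (A : comNzRingType) (C J : A -> Prop) (a : A) : Prop :=
  forall K, ideal K -> (forall c j, C c -> J j -> K (c * j)) -> K a.

(** The first Tor of the quotients by [J] and by a regular sequence on the
    quotient by [J] vanishes, so that [J] meets the ideal of the sequence in
    their product.  Regularity is used to cancel [x] in a relation
    [(c + e) * x] in [J]. *)
Lemma regmod_cap (A : comNzRingType) (C J : A -> Prop) (xs : seq A) p :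
  ideal C -> ideal J -> {in xs, forall x, C x} -> regmod J xs ->
  J p -> rspan A xs p -> prodI C J p.
Proof.
move=> iC; elim: xs J p => [|x xs IH] J p iJ xsC /=.
  by move=> _ _ -> K iK _; exact: (ideal0 iK).
have Cx : C x by apply: xsC; rewrite mem_head.
have {}xsC : {in xs, forall y, C y}.
  by move=> y yxs; apply: xsC; rewrite in_cons yxs orbT.
move=> [xJ xsr] Jp [c [b [_ bP ep]]].
have [q [e [qP Ce eb]]] : exists q e, [/\ prodI C J q, C e & b = q + e * x].
  have [||||q [e H]] := IH (adjoin J x) b _ xsC xsr _ bP
      (fun b => exists q e, [/\ prodI C J q, C e & b = q + e * x]).
  - exact: adjoin_ideal.
  - by exists p, (- c); split=> //; rewrite ep mulNr addrC addKr.
  - split; first exists 0, 0; first split.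
    + by move=> K iK _; exact: (ideal0 iK).
    + exact: ideal0.
    + by rewrite mul0r addr0.
    + move=> _ _ [q [e [qP Ce ->]]] [q' [e' [qP' Ce' ->]]].
      exists (q + q'), (e + e'); rewrite mulrDl addrACA; split=> //.
        by move=> K iK KP; apply: (idealD iK); [apply: qP|apply: qP'].
      exact: idealD.
    + move=> r _ [q [e [qP Ce ->]]]; exists (r * q), (r * e).
      rewrite mulrDr mulrA; split=> //; last exact: idealM.
      by move=> K iK KP; apply: (idealM iK); apply: qP.
  - move=> d _ Cd [m [r [Jm ->]]]; exists (d * m), (d * r).
    rewrite mulrDr mulrA; split=> //; last exact: idealMl.
    by move=> K iK KP; exact: KP.
  by exists q, e.
move=> K iK KP; have Jce : J (c + e).
  apply: xJ; apply: (idealDr (a := q)) => //.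
    by apply: qP => // d j _; apply: idealM.
  by move: Jp; rewrite ep eb addrCA -mulrDl mulrC.
rewrite ep eb addrCA; apply: (idealD iK); first exact: (qP K iK KP).
by rewrite -[c *: _]/(c * x) -mulrDl mulrC; apply: KP.
Qed.

(** By the principal ideal theorem the quotient by [P 0] and by the first
    generator has a chain of length [d - 1], so by induction [xs] is regular on
    the quotient by [P 0].  Then [P 0], which lies in the ideal of [xs], is
    equal to its product with the maximal ideal, and vanishes by Nakayama's
    lemma.  The vanishing of the first prime serves in the induction to exclude
    that the first generator lies in [P 0]. *)
Theorem regular_local_gens d (A : comNzRingType) (xs : seq A) P :
  noeth A -> local A -> size xs = d ->
  (forall a : A, nonunit a <-> rspan A xs a) -> prime_chain d P ->
  regmod (@zero_ideal A) xs /\ incl (P 0) (@zero_ideal A).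
Proof.
elim: d A xs P => [|d IH] A xs P nA lA.
  move=> /size0nil -> xsm [pP _]; split=> // a Pa; apply/xsm.
  by apply: proper_nonunit Pa; [apply: prime_idealW; apply: pP|apply: prime1; apply: pP].
case: xs => // x xs [sxs] xsm [pP ltP].
have pm := nonunit_prime lA; have im := prime_idealW pm.
have pP0 := pP 0%N isT; have iP0 := prime_idealW pP0.
have Pm i : (i <= d.+1)%N -> incl (P i) (@nonunit A).
  by move=> /pP pPi; apply: proper_nonunit; [apply: prime_idealW|apply: prime1].
have quot J : ideal J -> incl J (@nonunit A) -> J x ->
    exists (B : comNzRingType) (f : {rmorphism A -> B}),
      [/\ is_quot f J, noeth B, local B & forall b : B, nonunit b <-> rspan B (map f xs) b].
  move=> iJ Jm Jx; have [|B [f fq]] := quot_ex iJ; first by move=> /Jm/prime1; apply.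
  exists B, f; split=> //; [exact: quot_noeth fq nA|exact: quot_local fq lA Jm|].
  have [fs fK] := fq; move=> b; rewrite rspan_quot //.
  have [a <-] := fs b; rewrite (quot_nonunit fq lA Jm) xsm /=; split.
    move=> [c [w [_ wP ->]]]; exists w => //.
    by rewrite rmorphD rmorphM (proj2 (fK x) Jx) mulr0 add0r.
  move=> [w wP fw]; apply/xsm; rewrite -(subrK w a); apply: (idealD im).
    by apply: Jm; apply/fK; rewrite rmorphB fw subrr.
  by apply/xsm; exists 0, w; rewrite scale0r add0r.
(* If [x] were in [P 0], the quotient by [P 0] would have one generator less,
   and a chain of length [d] that starts at the nonzero prime [P 1]. *)
have [P0x|P0x] := pselect (P 0%N x).
  have [|B [f [fq nB lB mB]]] := quot _ iP0 _ P0x; first exact: Pm.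
  have [P01 []] := ltP 0%N isT.
  have [||_ P1] := IH B (map f xs) (fun i => img f (P i.+1)) nB lB _ mB.
  - by rewrite size_map.
  - apply: (quot_chain (P := fun i => P i.+1) fq) => //.
    by split=> i lt; [exact: (pP i.+1)|exact: (ltP i.+1)].
  by move=> a P1a; apply/(proj2 fq); apply: P1; exists a.
(* The last prime of the chain is replaced by the maximal ideal, so as to
   contain [x]. *)
pose P' i := if (i <= d)%N then P i else @nonunit A.
have mx : nonunit x by apply/xsm; apply: (@span_mem A A^o); rewrite mem_head.
have [||Q [cQ PQ Qx _]] := @prime_chain_through A d P' x nA; rewrite /P' ?ltnn //.
  split=> i; first by case: ifP => // lid _; apply: pP; apply: leqW.
  rewrite ltnS => lid; rewrite lid; case: ltnP => [lt|ge]; first exact: ltP.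
  have [le nle] := ltP i lid; split; first by apply: Pm; apply: leqW.
  by move=> mP; apply: nle => a /Pm/mP; apply.
pose J := adjoin (P 0%N) x.
have iJ : ideal J by apply: adjoin_ideal.
have [||B [f [fq nB lB mB]]] := quot J iJ.
- by apply: adjoin_min => //; apply: Pm.
- exact: adjoin_mem.
have [||rB _] := IH B (map f xs) (fun i => img f (Q i)) nB lB _ mB.
- by rewrite size_map.
- apply: (quot_chain fq) => //; apply: adjoin_min => //.
  by apply: prime_idealW; apply: (proj1 cQ).
have xsr : regmod (P 0%N) (x :: xs).
  by split; [move=> a; apply: prime_cancel|apply/(regmod_quot _ fq)].
suff P00 : incl (P 0%N) (@zero_ideal A).
  split=> //; rewrite (_ : @zero_ideal A = P 0%N) //; apply: incl_ext => a.
  by split=> [->|/P00//]; apply: ideal0.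
have [gs gsP] := nA _ iP0 => a /gsP.
apply: (@nakayama_local A A^o) => //; first exact: ideal_submod (zero_ideal_ideal A).
move=> g /(@span_mem A A^o)/gsP P0g; exists 0, g; rewrite add0r; split=> //.
have := @regmod_cap A (@nonunit A) (P 0%N) (x :: xs) g im iP0 _ xsr P0g.
apply; [|by apply/xsm; apply: Pm P0g|apply: submod_ideal; apply: cspan_submod|] => //.
  by move=> y yxs; apply/xsm; apply: (@span_mem A A^o).
by move=> c j mc /gsP jP; apply: (@cspanZ A A^o).
Qed.
(** * Minimal generators and syzygies *)

Lemma lspan_image (A : comNzRingType) (V W : lmodType A) (h : V -> W) gs w :
  h 0 = 0 -> (forall c u v, h (c *: u + v) = c *: h u + h v) ->
  lspan (map h gs) w <-> exists2 v, lspan gs v & h v = w.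
Proof.
move=> h0 hP; elim: gs w => [|g gs IH] w /=.
  by split=> [->|[_ -> <-]//]; exists 0.
split=> [[c [_ [_ /IH[v vP <-] ->]]]|[_ [c [v [_ vP ->]]] <-]].
  by exists (c *: g + v); rewrite ?hP //; exists c, v.
by exists c, (h v); rewrite hP; split=> //; apply/IH; exists v.
Qed.

Lemma noeth_cV (A : comNzRingType) n (S : 'cV[A]_n -> Prop) :
  noeth A -> submod S -> fg S.
Proof.
move=> nA; elim: n S => [|n IH] S sS.
  exists [::] => v; split=> [_|->]; last exact: submod0.
  exact: flatmx0.
pose hd (v : 'cV[A]_(1 + n)) : A^o := v 0 0.
pose z (w : 'cV[A]_n) : 'cV[A]_(1 + n) := col_mx 0 w.
have hdP c u v : hd (c *: u + v) = c *: hd u + hd v by rewrite /hd !mxE.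
have zP c u v : z (c *: u + v) = c *: z u + z v.
  by rewrite /z scale_col_mx add_col_mx scaler0 addr0.
have z0 : z 0 = 0 by rewrite /z col_mx0.
have [|xs xsP] := nA (img hd S).
  split; first by exists 0; [apply: submod0|rewrite /hd mxE].
    move=> _ _ [u Su <-] [v Sv <-]; exists (u + v); first exact: submodD.
    by rewrite /hd mxE.
  move=> r _ [u Su <-]; exists (r *: u); first exact: submodZ.
  by rewrite /hd mxE.
have [vs [vsS exs]] : exists vs, {in vs, forall v, S v} /\ map hd vs = xs.
  have : {in xs, forall a, img hd S a}.
    by move=> a /(@span_mem A A^o)/xsP.
  elim: (xs) => [|x ys IHy] ysP; first by exists [::].
  have [|vs [vsS <-]] := IHy.
    by move=> y yys; apply: ysP; rewrite in_cons yys orbT.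
  have [v Sv <-] := ysP x (mem_head _ _); exists (v :: vs); split=> // u.
  by rewrite in_cons => /orP[/eqP->//|/vsS].
have [|ws wsP] := IH (fun w => S (z w)).
  split=> [|u v Su Sv|c u Su].
  - by rewrite z0; apply: submod0.
  - by rewrite -[u]scale1r zP scale1r; apply: submodD.
  - by rewrite -[c *: u]addr0 zP z0 addr0; apply: submodZ.
exists (vs ++ map z ws) => v; split=> [Sv|]; last first.
  apply: span_min => // g; rewrite mem_cat => /orP[/vsS//|/mapP[w wws ->]].
  by apply/wsP; apply: span_mem.
have : lspan xs (hd v : A^o) by apply/xsP; exists v.
rewrite -exs => /(lspan_image _ _ (mxE _ _ _ _) hdP)[u uP huv].
have e0 : usubmx (v - u : 'cV_(1 + n)) = 0.
  by apply/matrixP => i j; rewrite !ord1 !mxE lshift0 -/(hd v) -/(hd u) huv subrr.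
have ev : v - u = z (dsubmx (v - u : 'cV_(1 + n))).
  by rewrite /z -e0 vsubmxK.
have cat_l := span_le (hs := vs ++ map z ws) (gs := vs).
have cat_r := span_le (hs := vs ++ map z ws) (gs := map z ws).
rewrite -(subrK u v); apply: (submodD (span_submod _)).
  apply: cat_r => [g|]; first by rewrite mem_cat orbC => ->.
  apply/(lspan_image _ _ z0 zP); exists (dsubmx (v - u : 'cV_(1 + n))) => //.
  apply/wsP; rewrite -ev; apply: submodB => //.
  by apply: (span_min _ _ uP).
by apply: cat_l => // g; rewrite mem_cat => ->.
Qed.

Definition generates_mx (A : comNzRingType) u g (M : 'M[A]_(u, g))
    (S : 'cV[A]_u -> Prop) : Prop :=
  forall v, S v <-> exists w, v = M *m w.

Definition mker (A : comNzRingType) u g (M : 'M[A]_(u, g)) (w : 'cV[A]_g) : Prop :=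
  M *m w = 0.

Definition entries_in (A : comNzRingType) (I : A -> Prop) n (v : 'cV[A]_n) : Prop :=
  forall i, I (v i 0).

(** Over a local ring, generators are minimal in number exactly when no
    relation between them has an invertible coefficient. *)
Definition mingen (A : comNzRingType) u g (M : 'M[A]_(u, g))
    (S : 'cV[A]_u -> Prop) : Prop :=
  generates_mx M S /\ incl (mker M) (entries_in (@nonunit A) (n := g)).

Lemma mker_submod (A : comNzRingType) u g (M : 'M[A]_(u, g)) : submod (mker M).
Proof.
rewrite /mker; split=> [|v w Mv Mw|a v Mv]; first by rewrite mulmx0.
  by rewrite mulmxDr Mv Mw addr0.
by rewrite -scalemxAr Mv scaler0.
Qed.

Lemma generates_submod (A : comNzRingType) u g (M : 'M[A]_(u, g)) S :
  generates_mx M S -> submod S.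
Proof.
move=> MS; split=> [|v w /MS[x ->] /MS[y ->]|a v /MS[x ->]]; apply/MS.
- by exists 0; rewrite mulmx0.
- by exists (x + y); rewrite mulmxDr.
- by exists (a *: x); rewrite -scalemxAr.
Qed.

Lemma entries_mulmx (A : comNzRingType) (I : A -> Prop) m n (M : 'M[A]_(m, n)) w :
  ideal I -> entries_in I w -> entries_in I (M *m w).
Proof.
by move=> iI Iw i; rewrite mxE; apply: ideal_sum => // j _; apply: (idealM iI).
Qed.

Lemma fg_generates (A : comNzRingType) u (S : 'cV[A]_u -> Prop) :
  fg S -> exists g (M : 'M[A]_(u, g)), generates_mx M S.
Proof.
move=> [gs gsP].
suff [g [M MP]] : exists g (M : 'M[A]_(u, g)), generates_mx M (lspan gs).
  by exists g, M => v; rewrite gsP.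
elim: (gs) => [|h hs [g [M MP]]].
  exists 0%N, (0 : 'M[A]_(u, 0)) => v; split=> [->|[w ->]].
    by exists 0; rewrite mulmx0.
  by rewrite mul0mx; apply: submod0 (span_submod _).
exists (1 + g)%N, (row_mx h M) => v /=; split.
  move=> [c [_ [_ /MP[w ->] ->]]]; exists (col_mx c%:M w).
  by rewrite mul_row_col mul_mx_scalar.
move=> [w ->]; rewrite -[w]vsubmxK mul_row_col.
exists (usubmx w 0 0), (M *m dsubmx w); split=> //; first by apply/MP; exists (dsubmx w).
by rewrite -mul_mx_scalar -mx11_scalar.
Qed.

Lemma mulmx_col' (A : comNzRingType) u g (M : 'M[A]_(u, g)) (w : 'cV[A]_g) i :
  w i 0 = 0 -> M *m w = col' i M *m row' i w.
Proof.
move=> w0; apply/colP => k; rewrite !mxE (bigD1_ord i) //= w0 mulr0 add0r.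
by apply: eq_bigr => j _; rewrite !mxE.
Qed.

Lemma mingen_ex (A : comNzRingType) u g0 (M0 : 'M[A]_(u, g0)) S :
  generates_mx M0 S ->
  exists g (M : 'M[A]_(u, g)), (g <= g0)%N /\ mingen M S.
Proof.
elim: g0 M0 => [|g0 IH] M0 M0S.
  by exists 0%N, M0; split=> //; split=> // w _ [].
have [min|] := pselect (incl (mker M0) (entries_in (@nonunit A) (n := g0.+1))).
  by exists g0.+1, M0.
move=> nmin; have [w [i [Mw /unit_ex[c cw]]]] :
    exists w i, mker M0 w /\ ~ nonunit (w i 0).
  apply: contrapT => no; apply: nmin => w Mw i.
  by apply: contrapT => nwi; apply: no; exists w, i.
have [|g [M [gle MP]]] := IH (col' i M0); last first.
  by exists g, M; split=> //; apply: leqW.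
move=> v; split=> [/M0S[x ->]|[x ->]]; last first.
  (* The coefficients [x], with a zero inserted at the place of the generator
     that is left out. *)
  pose y : 'cV[A]_g0.+1 := \col_k oapp (fun j => x j 0) 0 (unlift i k).
  apply/M0S; exists y; rewrite (@mulmx_col' _ _ _ _ _ i); last first.
    by rewrite mxE unlift_none.
  by congr (_ *m _); apply/colP => k; rewrite !mxE liftK.
exists (row' i (x - (x i 0 * c) *: w)).
transitivity (M0 *m (x - (x i 0 * c) *: w)).
  by rewrite mulmxBr -scalemxAr Mw scaler0 subr0.
by apply: mulmx_col'; rewrite !mxE -mulrA cw mulr1 subrr.
Qed.

Lemma noeth_mingen (A : comNzRingType) u (S : 'cV[A]_u -> Prop) :
  noeth A -> submod S -> exists g (M : 'M[A]_(u, g)), mingen M S.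
Proof.
move=> nA /(noeth_cV nA)/fg_generates[g0 [M0 /mingen_ex[g [M [_ MP]]]]].
by exists g, M.
Qed.

(** [S] has a minimal free resolution of length less than [p] whose matrices,
    from the second one on, have all their entries in [I].  The definition
    asks this of all minimal resolutions: they are isomorphic, but it is easier
    to prove it for all of them than to compare two. *)
Fixpoint fres (A : comNzRingType) (I : A -> Prop) (p : nat) u
    (S : 'cV[A]_u -> Prop) : Prop :=
  if p is p'.+1 then
    forall g (M : 'M[A]_(u, g)), mingen M S ->
      incl (mker M) (entries_in I (n := g)) /\ fres I p' (mker M)
  else forall v, S v -> v = 0.

Definition dsum (A : comNzRingType) u v (S1 : 'cV[A]_u -> Prop)
    (S2 : 'cV[A]_v -> Prop) (w : 'cV[A]_(u + v)) : Prop :=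
  S1 (usubmx w) /\ S2 (dsubmx w).

(** The direct sum of minimal resolutions of [S1] and [S2] is one of the minimal
    resolutions of [dsum S1 S2] to which the hypothesis applies. *)
Lemma fres_summand (A : comNzRingType) (I : A -> Prop) p u v
    (S1 : 'cV[A]_u -> Prop) (S2 : 'cV[A]_v -> Prop) :
  noeth A -> submod S1 -> submod S2 -> fres I p (dsum S1 S2) -> fres I p S2.
Proof.
move=> nA; elim: p u v S1 S2 => [|p IH] u v S1 S2 sS1 sS2 /= res.
  move=> w S2w; have := res (col_mx 0 w); rewrite /dsum col_mxKu col_mxKd.
  by move=> /(_ (conj (submod0 sS1) S2w))/eqP; rewrite col_mx_eq0 => /andP[_ /eqP].
move=> g2 M2 [M2S M2m]; have [g1 [M1 [M1S M1m]]] := noeth_mingen nA sS1.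
have kerE : mker (block_mx M1 0 0 M2) = dsum (mker M1) (mker M2).
  apply: incl_ext => w; rewrite -[w]vsubmxK /mker /dsum col_mxKu col_mxKd.
  rewrite mul_block_col !mul0mx addr0 add0r; split=> [/eqP|[-> ->]].
    by rewrite col_mx_eq0 => /andP[/eqP-> /eqP->].
  by rewrite col_mx0.
have [|kerI kerres] := res _ (block_mx M1 0 0 M2).
  split=> [w|w]; rewrite ?kerE; last first.
    move=> [/M1m w1m /M2m w2m] i; rewrite -[w]vsubmxK.
    by case: (split_ordP i) => j ->; rewrite ?col_mxEu ?col_mxEd.
  split=> [[/M1S[w1 e1] /M2S[w2 e2]]|[y ->]].
    exists (col_mx w1 w2); rewrite -[w]vsubmxK e1 e2 mul_block_col !mul0mx.
    by rewrite addr0 add0r.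
  rewrite /dsum -[y]vsubmxK mul_block_col !mul0mx addr0 add0r col_mxKu col_mxKd.
  by split; [apply/M1S; exists (usubmx y)|apply/M2S; exists (dsubmx y)].
rewrite kerE in kerI kerres; split; last first.
  by apply: (IH _ _ (mker M1)) => //; apply: mker_submod.
move=> w M2w i; have := kerI (col_mx 0 w) _ (rshift g1 i); rewrite col_mxEd; apply.
by rewrite /dsum col_mxKu col_mxKd; split=> //; apply: submod0 (mker_submod _).
Qed.

(** The last nonzero module of the resolution is free, and embedded in another
    free module with all coordinates in [I]: so an element that annihilates [I]
    annihilates a nonzero free module. *)
Lemma fres_faithful (A : comNzRingType) (I : A -> Prop) p u
    (S : 'cV[A]_u -> Prop) (c : A) :
  noeth A -> submod S -> fres I p S -> incl S (entries_in I (n := u)) ->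
  (exists2 v, S v & v <> 0) -> (forall a, I a -> c * a = 0) -> c = 0.
Proof.
move=> nA; elim: p u S => [|p IH] u S sS /= res SI [v Sv vn0] cI.
  by case: vn0; apply: res.
have [g [M Mmin]] := noeth_mingen nA sS; have [kI kres] := res g M Mmin.
have [kn0|k0] := pselect (exists2 w, mker M w & w <> 0).
  by apply: IH kres kI kn0 cI; apply: mker_submod.
have [MS _] := Mmin; have [w ew] := proj1 (MS v) Sv.
have cw0 x : c *: x = 0 :> 'cV[A]_g.
  apply: contrapT => n0; apply: k0; exists (c *: x) => //.
  rewrite /mker -scalemxAr; apply/colP => i; rewrite !mxE -[RHS](cI ((M *m x) i 0)).
    by rewrite mxE.
  by apply: SI; apply/MS; exists x.
case: g M Mmin kI kres k0 MS w ew cw0 => [|g] M _ _ _ _ _ w ew cw0.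
  by case: vn0; rewrite ew (flatmx0 w) mulmx0.
by have := cw0 (const_mx 1) => /colP/(_ 0); rewrite !mxE mulr1.
Qed.
(** * Reduction modulo a nonzerodivisor *)

Definition nzd (A : comNzRingType) (x : A) : Prop := forall a, x * a = 0 -> a = 0.

Definition principal (A : comNzRingType) (x : A) : A -> Prop :=
  adjoin (@zero_ideal A) x.

Lemma principalE (A : comNzRingType) (x a : A) :
  principal x a <-> exists r, a = r * x.
Proof.
split=> [[m [r [-> ->]]]|[r ->]]; first by exists r; rewrite add0r.
by exists 0, r; rewrite add0r.
Qed.

Lemma principal_ideal (A : comNzRingType) (x : A) : ideal (principal x).
Proof. exact: adjoin_ideal (zero_ideal_ideal A). Qed.

Lemma principal_nonunit (A : comNzRingType) (x : A) :
  local A -> nonunit x -> incl (principal x) (@nonunit A).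
Proof.
move=> /nonunit_ideal im mx; apply: adjoin_min => // _ ->; exact: ideal0.
Qed.

Lemma matrix_choice (A : Type) m n (P : 'I_m -> 'I_n -> A -> Prop) :
  (forall i j, exists a, P i j a) ->
  exists M : 'M[A]_(m, n), forall i j, P i j (M i j).
Proof.
move=> H; have [F FP] := choice (fun ij : 'I_m * 'I_n => H ij.1 ij.2).
by exists (\matrix_(i, j) F (i, j)) => i j; rewrite mxE; apply: (FP (i, j)).
Qed.

Lemma lift_mx (A B : comNzRingType) (f : {rmorphism A -> B}) m n (M : 'M[B]_(m, n)) :
  (forall b, exists a, f a = b) -> exists N, map_mx f N = M.
Proof.
move=> fs; have [|N NP] := @matrix_choice A m n (fun i j a => f a = M i j).
  by move=> i j; apply: fs.
by exists N; apply/matrixP => i j; rewrite mxE.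
Qed.

Lemma map_mx_eq0_quot (A B : comNzRingType) (f : {rmorphism A -> B}) x n
    (v : 'cV[A]_n) :
  is_quot f (principal x) -> map_mx f v = 0 <-> exists w, v = x *: w.
Proof.
move=> [_ fK]; split=> [/matrixP fv|[w ->]]; last first.
  apply/matrixP => i j; rewrite !mxE; apply/fK/principalE.
  by exists (w i j); rewrite mulrC.
have [|w wP] := @matrix_choice A n 1 (fun i j a => v i j = x * a).
  move=> i j; have := fv i j; rewrite !mxE => /fK/principalE[r ->].
  by exists r; rewrite mulrC.
by exists w; apply/matrixP => i j; rewrite !mxE.
Qed.

Definition xsat (A : comNzRingType) (x : A) n (S : 'cV[A]_n -> Prop) : Prop :=
  forall v, S (x *: v) -> S v.

Lemma nzd_scale (A : comNzRingType) (x : A) n (v : 'cV[A]_n) :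
  nzd x -> x *: v = 0 -> v = 0.
Proof.
move=> xnzd /colP xv; apply/colP => i; rewrite mxE; apply: xnzd.
by have := xv i; rewrite !mxE.
Qed.

Lemma mker_xsat (A : comNzRingType) (x : A) u g (M : 'M[A]_(u, g)) :
  nzd x -> xsat x (mker M).
Proof. by move=> xnzd v; rewrite /mker -scalemxAr => /(nzd_scale xnzd). Qed.

Lemma img_submod (A B : comNzRingType) (f : {rmorphism A -> B}) n
    (S : 'cV[A]_n -> Prop) :
  (forall b, exists a, f a = b) -> submod S -> submod (img (map_mx f) S).
Proof.
move=> fs sS; split; first by exists 0; [apply: submod0|rewrite map_mx0].
  move=> _ _ [v Sv <-] [w Sw <-]; exists (v + w); first exact: submodD.
  by rewrite map_mxD.
move=> a _ [v Sv <-]; have [c <-] := fs a; exists (c *: v); first exact: submodZ.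
by rewrite map_mxZ.
Qed.

(** Tensoring with the quotient by [x] commutes with syzygies as long as [x] is
    regular on the module that is resolved. *)
Lemma mker_map (A B : comNzRingType) (f : {rmorphism A -> B}) x u g
    (M : 'M[A]_(u, g)) S :
  is_quot f (principal x) -> nzd x -> xsat x S -> generates_mx M S ->
  mker (map_mx f M) = img (map_mx f) (mker M).
Proof.
move=> fq xnzd satS MS; have [fs _] := fq; apply: incl_ext => w; split; last first.
  by move=> [v Mv <-]; rewrite /mker -map_mxM Mv map_mx0.
have [v <-] := lift_mx w fs; rewrite /mker -map_mxM.
move=> /(map_mx_eq0_quot _ fq)[t et].
have /MS[s es] : S t by apply: satS; rewrite -et; apply/MS; exists v.
exists (v - x *: s); first by rewrite /mker mulmxBr -scalemxAr et es subrr.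
rewrite map_mxB (_ : map_mx f (x *: s) = 0) ?subr0 //.
by apply/(map_mx_eq0_quot _ fq); exists s.
Qed.

Lemma mingen_map (A B : comNzRingType) (f : {rmorphism A -> B}) x u g
    (M : 'M[A]_(u, g)) S :
  is_quot f (principal x) -> local A -> nonunit x -> nzd x -> xsat x S ->
  mingen M S -> mingen (map_mx f M) (img (map_mx f) S).
Proof.
move=> fq lA mx xnzd satS [MS Mm]; have [fs _] := fq.
have nuE := quot_nonunit fq lA (principal_nonunit lA mx).
split; last first.
  rewrite (mker_map fq xnzd satS MS) => _ [w /Mm wm <-] i.
  by rewrite mxE nuE.
move=> v; split=> [[_ /MS[w ->] <-]|[w ->]].
  by exists (map_mx f w); rewrite map_mxM.
have [t <-] := lift_mx w fs; exists (M *m t); last by rewrite map_mxM.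
by apply/MS; exists t.
Qed.

Lemma submod_small (A : comNzRingType) (x : A) n (S N : 'cV[A]_n -> Prop) :
  noeth A -> local A -> nonunit x -> submod S -> submod N ->
  (forall v, S v -> exists m t, [/\ N m, S t & v = m + x *: t]) -> incl S N.
Proof.
move=> nA lA mx sS sN SN v; have [gs gsP] := noeth_cV nA sS.
move=> /gsP; apply: nakayama_local => // g /span_mem/gsP/SN[m [t [Nm St ->]]].
exists m, (x *: t); split=> //; apply: cspanZ => //; first exact: nonunit_ideal.
exact/gsP.
Qed.

(** Minimal resolutions over [A] reduce to minimal resolutions over [B], and by
    Nakayama's lemma a module whose reduction is zero is zero. *)
Lemma fres_of_reduction (A B : comNzRingType) (f : {rmorphism A -> B}) x p u
    (S : 'cV[A]_u -> Prop) :
  is_quot f (principal x) -> noeth A -> local A -> nonunit x -> nzd x ->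
  submod S -> xsat x S ->
  fres (@nonunit B) p (img (map_mx f) S) -> fres (@nonunit A) p S.
Proof.
move=> fq nA lA mx xnzd; elim: p u S => [|p IH] u S sS satS /=.
  move=> S0; apply: (submod_small nA lA mx sS (N := fun v => v = 0)).
    by split=> // [v w -> ->|a v ->]; rewrite ?addr0 ?scaler0.
  move=> v Sv; have /(map_mx_eq0_quot _ fq)[t et] : map_mx f v = 0.
    by apply: S0; exists v.
  exists 0, t; rewrite add0r; split=> //.
  by apply: satS; rewrite -et.
move=> res g M Mmin; have [MS Mm] := Mmin; split=> //.
apply: IH; [exact: mker_submod|exact: mker_xsat|].
rewrite -(mker_map fq xnzd satS MS).
by have [] := res _ _ (mingen_map fq lA mx xnzd satS Mmin).
Qed.

(** Conversely, all minimal resolutions over [B] come from [A]. *)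
Lemma fres_reduction (A B : comNzRingType) (f : {rmorphism A -> B}) I x p u
    (S : 'cV[A]_u -> Prop) :
  is_quot f (principal x) -> noeth A -> local A -> nonunit x -> nzd x ->
  submod S -> xsat x S ->
  fres I p S -> fres (img f I) p (img (map_mx f) S).
Proof.
move=> fq nA lA mx xnzd; have [fs _] := fq; elim: p u S => [|p IH] u S sS satS /=.
  by move=> S0 _ [v /S0 -> <-]; rewrite map_mx0.
move=> res g M [MS Mm].
(* A minimal system of generators of the reduction lifts to a minimal system of
   generators. *)
have ex j : exists v, S v /\ map_mx f v = col j M.
  have [|v Sv ev] := proj2 (MS (col j M)); last by exists v.
  by exists (delta_mx j 0); rewrite colE.
have [F FP] := choice ex.
pose N := \matrix_(i, j) F j i 0.
have eM : map_mx f N = M.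
  by apply/matrixP => i j; have [_ /colP/(_ i)] := FP j; rewrite !mxE.
have SN w : S (N *m w).
  rewrite (_ : N *m w = \sum_j w j 0 *: F j); last first.
    apply/colP => i; rewrite !mxE summxE; apply: eq_bigr => j _.
    by rewrite !mxE mulrC.
  apply: big_ind => [|v v' Sv Sv'|j _]; [exact: submod0|exact: submodD|].
  by apply: submodZ => //; case: (FP j).
have NS : generates_mx N S.
  move=> v; split=> [|[w ->//]]; move: v.
  apply: (submod_small nA lA mx sS).
    by apply: (generates_submod (M := N)) => v; split=> [[w ->]|[w ->]]; exists w.
  move=> v Sv; have [|w ew] := proj1 (MS (map_mx f v)); first by exists v.
  have [t et] := lift_mx w fs.
  have /(map_mx_eq0_quot _ fq)[s es] : map_mx f (v - N *m t) = 0.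
    by rewrite map_mxB map_mxM eM et ew subrr.
  exists (N *m t), s; split; first by exists t.
    by apply: satS; rewrite -es; apply: submodB.
  by rewrite -es addrC subrK.
have nuE := quot_nonunit fq lA (principal_nonunit lA mx).
have [|kI kres] := res g N.
  split=> // w Nw i; rewrite -nuE.
  have -> : f (w i 0) = map_mx f w i 0 by rewrite mxE.
  by apply: Mm; rewrite /mker -eM -map_mxM Nw map_mx0.
rewrite -eM (mker_map fq xnzd satS NS); split; last first.
  by apply: IH kres; [apply: mker_submod|apply: mker_xsat].
by move=> _ [w /kI wI <-] i; rewrite mxE; exists (w i 0).
Qed.

(** A case of Hilbert's syzygy theorem.  The first element of the sequence is
    regular on every module of syzygies, so from the first of these on the
    resolution can be reduced modulo this element.  After [d] reductions the
    ring is a field, where relations with nonunit coefficients vanish. *)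
Theorem regular_fres d (A : comNzRingType) (xs : seq A) u (S : 'cV[A]_u -> Prop) :
  noeth A -> local A -> size xs = d ->
  (forall a : A, nonunit a <-> rspan A xs a) -> regmod (@zero_ideal A) xs ->
  submod S -> fres (@nonunit A) d.+1 S.
Proof.
elim: d A xs u S => [|d IH] A xs u S nA lA.
  move=> /size0nil -> xsm _ sS g M [_ Mm]; split=> // w /Mm wm.
  by apply/colP => i; rewrite mxE; apply/xsm.
case: xs => // x xs [sxs] xsm [xnzd xsr] sS g M [MS Mm]; split=> //.
have mx : nonunit x by apply/xsm; apply: (@span_mem A A^o); rewrite mem_head.
have pm := principal_nonunit lA mx.
have [|B [f fq]] := quot_ex (principal_ideal x).
  by move=> /pm; apply: (prime1 (nonunit_prime lA)).
have [fs fK] := fq.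
have red := @fres_of_reduction A B f x d.+1 g (mker M) fq nA lA mx xnzd.
apply: red; [exact: mker_submod|exact: mker_xsat|].
apply: (IH B (map f xs)); first exact: quot_noeth fq nA.
- exact: quot_local fq lA pm.
- by rewrite size_map.
- move=> b; rewrite rspan_quot //.
  have [a <-] := fs b; rewrite (quot_nonunit fq lA pm) xsm /=; split.
    move=> [c [w [_ wP ->]]]; exists w => //.
    rewrite rmorphD rmorphM (_ : f x = 0) ?mulr0 ?add0r //.
    by apply/fK/principalE; exists 1; rewrite mul1r.
  move=> [w wP fw]; have /fK/principalE[r er] : f (a - w) = 0.
    by rewrite rmorphB fw subrr.
  by exists r, w; split=> //; rewrite -(subrK w a) er.
- exact/(regmod_quot _ fq).
- by apply: img_submod => //; apply: mker_submod.
Qed.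
(** * Prime avoidance in a coset *)

Definition ann (A : comNzRingType) (c a : A) : Prop := zero_ideal (a * c).

Definition max_ann (A : comNzRingType) (c : A) : Prop :=
  [/\ c <> 0, prime_ideal (ann c) &
    forall c', c' <> 0 -> incl (ann c) (ann c') -> incl (ann c') (ann c)].

Lemma ann_separate (A : comNzRingType) (cs : seq A) c0 :
  prime_ideal (ann c0) ->
  {in cs, forall c, exists t, ann c t /\ ~ ann c0 t} ->
  exists t, {in cs, forall c, ann c t} /\ ~ ann c0 t.
Proof.
move=> pc0; elim: cs => [|c cs IH] sep; first by exists 1; split=> //; apply: prime1.
have [t [tc tc0]] := sep c (mem_head _ _).
have [|s [scs sc0]] := IH; first by move=> d dcs; apply: sep; rewrite in_cons dcs orbT.
exists (t * s); split; last exact: primeM_notin.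
move=> d; rewrite in_cons /ann /zero_ideal => /orP[/eqP->|/scs sd].
  by rewrite mulrAC tc mul0r.
by rewrite -mulrA sd mulr0.
Qed.

(** The set of elements with a maximal annihilator has the same span as a finite
    subset [cs].  If the annihilator of such an element [c] contained the
    annihilator of no element of [cs], some [t] outside the prime [ann c] would
    annihilate [cs], hence [c]. *)
Lemma zero_divisors (A : comNzRingType) : noeth A ->
  exists cs : seq A, {in cs, forall c, max_ann c} /\
    forall z c, c <> 0 -> z * c = 0 -> exists2 d, d \in cs & z * d = 0.
Proof.
move=> nA; have [cs [csm csP]] := @noeth_fin_gen A (@max_ann A) nA.
exists cs; split=> // z h hn0 zh.
have [c [cn0 pc hc cmax]] := colon_prime nA (zero_ideal_ideal A) (h := h) hn0.
apply: contrapT => nod.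
have [|t [tcs tc]] := @ann_separate A cs c pc; last first.
  have : rspan A cs c by apply: csP; split.
  move=> /(@cspan_min A A^o _ _ (fun d => t * d = 0)) tc0; apply: tc.
  apply: tc0 => [|r d _ /tcs td]; last by rewrite mulrCA td mulr0.
  split=> [|u v tu tv|r u tu]; first by rewrite mulr0.
    by rewrite mulrDr tu tv addr0.
  by rewrite mulrCA tu mulr0.
move=> d dcs; have [dn0 pd dmax] := csm d dcs; apply: contrapT => nosep.
have dc : incl (ann d) (ann c).
  by move=> t td; apply: contrapT => tc; apply: nosep; exists t.
by apply: nod; exists d => //; apply: (dmax c cn0 dc); apply: hc.
Qed.

(** Prime avoidance.  If [a + b] lies in one more prime [ann c], it is moved by
    an element of [J] that lies in all the previous primes but not in [ann c]:
    there is one because the primes [ann d], for [d] in [cs], are incomparable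
    as soon as they are distinct. *)
Lemma coset_nzd (A : comNzRingType) (J : A -> Prop) a :
  noeth A -> ideal J ->
  (forall c, a * c = 0 -> (forall j, J j -> j * c = 0) -> c = 0) ->
  exists2 b, J b & nzd (a + b).
Proof.
move=> nA iJ faith; have [cs [csm csP]] := zero_divisors nA.
suff [b Jb bcs] : exists2 b, J b & {in cs, forall c, (a + b) * c <> 0}.
  exists b => // z abz; apply: contrapT => zn0.
  by have [d dcs /(bcs d dcs)] := csP _ _ zn0 abz.
elim: cs csm {csP} => [|c cs IH] csm; first by exists 0; first exact: ideal0.
have [|b Jb bcs] := IH.
  by move=> d dcs; apply: csm; rewrite in_cons dcs orbT.
have [cn0 pc cmax] := csm c (mem_head _ _).
have [abc|abc] := pselect ((a + b) * c = 0); last first.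
  by exists b => // d; rewrite in_cons => /orP[/eqP->|/bcs].
have [j Jj jc] : exists2 j, J j & ~ ann c j.
  apply: contrapT => noj; apply: cn0.
  have Jc j : J j -> j * c = 0.
    by move=> Jj; apply: contrapT => jc; apply: noj; exists j.
  by apply: faith => //; move: abc; rewrite mulrDl (Jc _ Jb) addr0.
have [|t [tcs tc]] := @ann_separate A cs c pc.
  move=> d dcs; have [|dn0 _ dmax] := csm d; first by rewrite in_cons dcs orbT.
  apply: contrapT => nosep; apply: (bcs d dcs); apply: (dmax c cn0 _ _ abc).
  by move=> t td; apply: contrapT => tc; apply: nosep; exists t.
exists (b + t * j); first by apply: idealD => //; apply: idealM.
move=> d; rewrite in_cons addrA mulrDl => /orP[/eqP->|dcs].
  by rewrite abc add0r; apply: (primeM_notin pc).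
by rewrite mulrAC [t * d](tcs d dcs) mul0r addr0; apply: bcs.
Qed.

(** * Ideals with a finite resolution whose syzygies lie in the ideal *)

Definition ideal_col (A : comNzRingType) (I : A -> Prop) (v : 'cV[A]_1) : Prop :=
  I (v 0 0).

Lemma ideal_col_submod (A : comNzRingType) (I : A -> Prop) :
  ideal I -> submod (ideal_col I).
Proof.
rewrite /ideal_col; move=> iI; split=> [|v w Iv Iw|a v Iv]; rewrite mxE.
- exact: ideal0.
- exact (idealD iI Iv Iw).
- exact (idealM iI a Iv).
Qed.

Lemma ideal_col_entries (A : comNzRingType) (I : A -> Prop) :
  incl (ideal_col I) (entries_in I (n := 1)).
Proof. by move=> v Iv i; rewrite ord1. Qed.

Lemma mul_row_col11 (A : comNzRingType) g (a : A) (N : 'M[A]_(1, g))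
    (w : 'cV[A]_(1 + g)) :
  row_mx a%:M N *m w = (usubmx w 0 0 * a)%:M + N *m dsubmx w.
Proof.
rewrite -{1}[w]vsubmxK mul_row_col; congr (_ + _).
by rewrite [usubmx w]mx11_scalar -scalar_mxM mulrC !mxE.
Qed.

Lemma mem_ideal_col (A : comNzRingType) (I : A -> Prop) a : ideal_col I a%:M <-> I a.
Proof. by rewrite /ideal_col mxE eqxx mulr1n. Qed.

(** Over [A / (a)], a syzygy [t] of [L] satisfies [L *m t = r * a] in [A], and
    then [r] is in [I] because all syzygies of [a, L] have their coefficients in
    [I].  On the other hand every [y] in [I] is modulo [a] the first coefficient
    of a syzygy of [a, L] whose other coefficients vanish modulo [a]: write [y] as a
    combination of [a, L] and multiply it by [a].  So [t] itself, and not only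
    the pair [(- r, t)], comes from a syzygy of [a, L].  This is the splitting
    of the surjection from [I / a I] to [I / (a)]. *)
Lemma syzygies_split (A B : comNzRingType) (f : {rmorphism A -> B}) I a g
    (L : 'M[A]_(1, g)) :
  is_quot f (principal a) -> ideal I ->
  generates_mx (row_mx a%:M L) (ideal_col I) ->
  incl (mker (row_mx a%:M L)) (entries_in I (n := 1 + g)) ->
  img (map_mx f) (mker (row_mx a%:M L)) =
    dsum (ideal_col (img f I)) (mker (map_mx f L)).
Proof.
move=> fq iI RI kI; have [fs fK] := fq.
have fa : f a = 0 by apply/fK/principalE; exists 1; rewrite mul1r.
have fM (w : 'cV[A]_(1 + g)) :
    map_mx f (row_mx a%:M L *m w) = map_mx f L *m map_mx f (dsubmx w).
  rewrite mul_row_col11 map_mxD map_mxM map_scalar_mx.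
  by rewrite rmorphM fa mulr0 /= raddf0 add0r.
apply: incl_ext => v; split=> [[w Rw <-]|[v1I Lv2]].
  split; last by rewrite /mker -map_dsubmx -fM Rw map_mx0.
  by exists (usubmx w 0 0); rewrite ?mxE //; apply: kI.
have [t et] := lift_mx (dsubmx v) fs.
have [r er] : exists r, L *m t = (r * a)%:M.
  have /(map_mx_eq0_quot _ fq)[s es] : map_mx f (L *m t) = 0.
    by rewrite map_mxM et.
  by exists (s 0 0); rewrite es {1}[s]mx11_scalar scale_scalar_mx mulrC.
have Ir : I (- r).
  have /kI/(_ (lshift g 0)) : mker (row_mx a%:M L) (col_mx (- r)%:M t).
    rewrite /mker mul_row_col11 col_mxKu col_mxKd er mxE eqxx mulr1n.
    by rewrite mulNr -raddfD addNr raddf0.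
  by rewrite col_mxEu mxE eqxx mulr1n.
have [y0 Iy0 ey0] := v1I; pose y := y0 + r.
have Iy : I y by rewrite /y -[r]opprK; apply: idealB.
have [c ec] := proj1 (RI y%:M) (proj2 (mem_ideal_col _ _) Iy).
rewrite mul_row_col11 in ec.
exists (col_mx (y - r - usubmx c 0 0 * a)%:M (t - a *: dsubmx c)).
  rewrite /mker mul_row_col11 col_mxKu col_mxKd mulmxBr er -scalemxAr.
  have -> : L *m dsubmx c = y%:M - (usubmx c 0 0 * a)%:M by rewrite ec addrC addKr.
  rewrite scalerBr !scale_scalar_mx mxE eqxx mulr1n -!raddfB -raddfD.
  by rewrite (_ : _ + _ = 0) ?raddf0 //; ring.
rewrite -[RHS]vsubmxK map_col_mx; congr col_mx.
  apply/matrixP => i j; rewrite !ord1 -ey0 !mxE eqxx mulr1n /y addrK.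
  by rewrite rmorphB rmorphM fa mulr0 subr0.
rewrite map_mxB et map_mxZ /= fa scale0r subr0 //.
Qed.
Lemma mulmx_lift (A : comNzRingType) u g h (M : 'M[A]_(u, g)) S (L : 'M[A]_(u, h)) :
  generates_mx M S -> (forall j, S (col j L)) -> exists Z, L = M *m Z.
Proof.
move=> MS SL; have ex j : exists z, col j L = M *m z by apply/MS.
have [F FP] := choice ex; exists (\matrix_(i, j) F j i 0).
apply/matrixP => i j; have /colP/(_ i) := FP j; rewrite !mxE => ->.
by apply: eq_bigr => k _; rewrite !mxE.
Qed.

(** If the coefficient of [a] were invertible in a relation between [a] and [L],
    then [a] would be a combination of the columns of [M] with nonunit
    coefficients; but it has another expression, where the first coefficient
    is [1]. *)
Lemma mingen_exchange (A : comNzRingType) (I : A -> Prop) g h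
    (M : 'M[A]_(1, 1 + g)) (w0 : 'cV[A]_g) (L : 'M[A]_(1, h))
    (a : A) :
  local A -> ideal I -> mingen M (ideal_col I) -> a%:M = M *m col_mx 1%:M w0 ->
  (forall j, I (L 0 j)) ->
  (forall i, I i -> exists r w, i%:M = (r * a)%:M + L *m w) ->
  (forall r w, (r * a)%:M + L *m w = 0 -> entries_in (@nonunit A) w) ->
  mingen (row_mx a%:M L) (ideal_col I).
Proof.
move=> lA iI [MS Mm] ea IL gen Lm; have im := nonunit_ideal lA.
have Ia : I a by apply/mem_ideal_col/MS; exists (col_mx 1%:M w0).
split=> [v|w].
  split=> [Iv|[w ->]].
    have [r [w e]] := gen _ Iv; exists (col_mx r%:M w).
    by rewrite mul_row_col11 col_mxKu col_mxKd mxE eqxx mulr1n -e -mx11_scalar.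
  rewrite mul_row_col11 /ideal_col !mxE eqxx mulr1n; apply: idealD => //.
    exact: idealM.
  by apply: ideal_sum => // j _; apply: idealMl.
rewrite /mker mul_row_col11 => Rw; have wm := Lm _ _ Rw.
move=> i; rewrite -[w]vsubmxK.
case: (split_ordP i) => j ->; rewrite ?col_mxEd ?col_mxEu //.
rewrite ord1 => {j}; apply: contrapT => /unit_ex[c cw].
have [Z eZ] : exists Z, L = M *m Z.
  by apply: (mulmx_lift MS) => j; rewrite /ideal_col mxE.
(* Here [a] is a combination of the entries of [L] with nonunit coefficients:
   a relation between the columns of [M] with coefficient [1 + m]. *)
have ker : mker M (col_mx 1%:M w0 + Z *m (c *: dsubmx w)).
  rewrite /mker mulmxDr mulmxA -eZ -ea -scalemxAr.
  have := congr1 (fun t => c *: t) Rw; rewrite scaler0 scalerDr => <-.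
  by rewrite scale_scalar_mx mulrA cw mul1r.
have := Mm _ ker (lshift g 0); rewrite mxE col_mxEu mxE eqxx mulr1n => n1.
apply: (prime1 (nonunit_prime lA)); apply: (idealDr im _ (b := 1)); last first.
  by rewrite addrC; apply: n1.
apply: entries_mulmx => // k; rewrite mxE; apply: (idealM im); apply: wm.
Qed.

Lemma no_generators (A : comNzRingType) (I : A -> Prop) (M : 'M[A]_(1, 0)) a :
  generates_mx M (ideal_col I) -> I a <-> a = 0.
Proof.
move=> MI; rewrite -(mem_ideal_col I) (MI _).
split=> [[w]|->]; last by exists 0; rewrite mulmx0 raddf0.
by rewrite (flatmx0 w) mulmx0 => /matrixP/(_ 0 0); rewrite !mxE eqxx mulr1n.
Qed.

(** By induction on the number of generators.  As the resolution is finite, [I]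
    has no annihilator, so some minimal generator [a] of [I] is a
    nonzerodivisor; and the hypothesis passes to [I / (a)], whose syzygies are a
    direct summand of the reduction of those of [I]. *)
Theorem fres_regular_sequence n (A : comNzRingType) (I : A -> Prop) p g
    (M : 'M[A]_(1, g)) :
  noeth A -> local A -> ideal I -> incl I (@nonunit A) -> (g <= n)%N ->
  generates_mx M (ideal_col I) -> fres I p (ideal_col I) ->
  exists ys, regmod (@zero_ideal A) ys /\ forall a, I a <-> rspan A ys a.
Proof.
elim: n A I p g M => [|n IH] A I p g0 M0 nA lA iI Im g0n M0I res.
  case: g0 g0n M0 M0I => // _ M0 M0I.
  by exists [::]; split=> // a; apply: no_generators M0I.
have [g [M [gle Mmin]]] := mingen_ex M0I; have {M0 M0I} [MI Mm] := Mmin.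
have {gle g0n} := leq_trans gle g0n.
case: g M Mmin MI Mm => [|g] M Mmin MI Mm gn.
  by exists [::]; split=> // a; apply: no_generators MI.
move: M Mmin MI Mm; rewrite -[g.+1]/(1 + g)%N => M Mmin MI Mm.
have im := nonunit_ideal lA; have n1 := prime1 (nonunit_prime lA).
pose e1 : 'cV[A]_(1 + g) := col_mx 1%:M 0.
have Mn0 : M *m e1 <> 0.
  move=> /Mm/(_ (@lshift 1 g 0)); rewrite /e1 col_mxEu mxE eqxx mulr1n; exact: n1.
have sI := ideal_col_submod iI.
have faith c : (forall a, I a -> c * a = 0) -> c = 0.
  apply: (fres_faithful nA sI res (@ideal_col_entries A I)).
  by exists (M *m e1) => //; apply/MI; exists e1.
pose N := rsubmx (M : 'M_(1, 1 + g)); pose a0 := M 0 0.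
have Mw (w : 'cV[A]_(1 + g)) : M *m w = (usubmx w 0 0 * a0)%:M + N *m dsubmx w.
  rewrite -mul_row_col11; congr (_ *m _); rewrite -[LHS](@hsubmxK _ 1 1 g).
  congr row_mx; rewrite [LHS]mx11_scalar mxE /a0; congr (M _ _)%:M.
  exact: val_inj.
have [||b [w0 eb] anzd] := @coset_nzd A (fun j => exists w, j%:M = N *m w) a0 nA.
- split; first by exists 0; rewrite mulmx0 raddf0.
    by move=> x y [u eu] [v ev]; exists (u + v); rewrite mulmxDr -eu -ev raddfD.
  by move=> r x [u eu]; exists (r *: u); rewrite -scalemxAr -eu scale_scalar_mx.
- move=> c a0c Nc; apply: faith => a Ia.
  have [w ew] := proj1 (MI _) (proj2 (mem_ideal_col I a) Ia).
  rewrite Mw in ew; set s := (N *m _) in ew.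
  have -> : a = usubmx w 0 0 * a0 + s 0 0.
    by move: ew => /matrixP/(_ 0 0); rewrite !mxE !eqxx !mulr1n.
  rewrite mulrC mulrDl -mulrA a0c mulr0 add0r; apply: Nc.
  by exists (dsubmx w); rewrite -mx11_scalar.
pose a := a0 + b.
have ea : a%:M = M *m col_mx 1%:M w0.
  by rewrite Mw col_mxKu col_mxKd mxE eqxx mulr1n mul1r -eb -raddfD.
have Ia : I a by apply/mem_ideal_col/MI; exists (col_mx 1%:M w0).
have ma := Im _ Ia.
have aI : incl (principal a) I by apply: adjoin_min => // _ ->; apply: ideal0.
have [|B [f fq]] := quot_ex (principal_ideal a); first by move=> /aI/Im/n1.
have [fs fK] := fq; have fa : f a = 0 by apply/fK/principalE; exists 1; rewrite mul1r.
have lB := quot_local fq lA (principal_nonunit lA ma).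
have nB := quot_noeth fq nA.
have nuE := quot_nonunit fq lA (principal_nonunit lA ma).
pose I' := img f I; have iI' : ideal I' := quot_ideal fq iI.
have memI' i : I' (f i) <-> I i := quot_img i fq iI aI.
(* Any minimal generators [L'] of [I'] lift to elements [L] that form minimal
   generators of [I] together with [a]. *)
have res' : fres I' p (ideal_col I').
  case: p res => [|p] res; first by case: Mn0; apply: res; apply/MI; exists e1.
  move=> h L' [L'I L'm].
  have [|L LP] := @matrix_choice A 1 h (fun i j x => I x /\ f x = L' i j).
    move=> i j; suff [x Ix ex] : I' (L' 0 j) by exists x; rewrite ord1.
    have : ideal_col I' (L' *m delta_mx j 0) by apply/L'I; exists (delta_mx j 0).
    by rewrite -colE /ideal_col mxE.
  have eL : map_mx f L = L' by apply/matrixP => i j; rewrite mxE; case: (LP i j).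
  have Rmin : mingen (row_mx a%:M L) (ideal_col I).
    apply: mingen_exchange Mmin ea _ _ _ => // [j|i Ii|r w Rw k].
    - by case: (LP 0 j).
    - have I'i : ideal_col I' (f i)%:M by apply/mem_ideal_col/memI'.
      have [w' ew'] := proj1 (L'I _) I'i.
      have [w ew] := lift_mx w' fs.
      have [r er] : exists r, i - (L *m w) 0 0 = r * a.
        apply/principalE/fK; rewrite rmorphB.
        have -> : f ((L *m w) 0 0) = (L' *m w') 0 0.
          by rewrite -eL -ew -map_mxM [RHS]mxE.
        by rewrite -ew' mxE eqxx mulr1n subrr.
      by exists r, w; rewrite [L *m w]mx11_scalar -er -raddfD subrK.
    - rewrite -nuE; have -> : f (w k 0) = map_mx f w k 0 by rewrite mxE.
      apply: L'm; rewrite /mker -eL -map_mxM.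
      have -> : L *m w = - (r * a)%:M by apply/eqP; rewrite -addr_eq0 addrC Rw.
      by rewrite map_mxN map_scalar_mx rmorphM fa mulr0 raddf0 oppr0.
  have [kI kres] := res _ _ Rmin; have [RI _] := Rmin.
  have split_ker := syzygies_split fq iI RI kI; rewrite eL in split_ker.
  have kres' : fres I' p (dsum (ideal_col I') (mker L')).
    rewrite -split_ker; apply: fres_reduction kres => //; first exact: mker_submod.
    exact: mker_xsat.
  split; last first.
    by apply: fres_summand kres' => //; [apply: ideal_col_submod|apply: mker_submod].
  move=> w L'w i.
  have : img (map_mx f) (mker (row_mx a%:M L)) (col_mx 0 w).
    rewrite split_ker; split; rewrite ?col_mxKu ?col_mxKd //.
    by rewrite /ideal_col mxE; apply: ideal0.
  move=> [v /kI vI /matrixP/(_ (rshift 1 i) 0)]; rewrite mxE col_mxEd => <-.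
  by exists (v (rshift 1 i) 0).
have [|||ys' [ys'r ys'I]] := IH B I' p g (map_mx f N) nB lB iI' _ _ _ res'.
- by move=> _ [i /Im mi <-]; rewrite nuE.
- exact: gn.
- move=> v; rewrite [v]mx11_scalar (mem_ideal_col I'); split=> [[i Ii ei]|[w ew]].
    have [w ew] := proj1 (MI _) (proj2 (mem_ideal_col I i) Ii).
    exists (map_mx f (dsubmx w - usubmx w 0 0 *: w0)).
    rewrite -ei -map_scalar_mx ew Mw -map_mxM mulmxBr -scalemxAr -eb.
    have -> : (usubmx w 0 0 * a0)%:M = (usubmx w 0 0 * a)%:M - (usubmx w 0 0 * b)%:M :> 'M_1.
      by rewrite -raddfB /a mulrDr addrK.
    rewrite scale_scalar_mx addrAC -addrA map_mxD map_scalar_mx rmorphM fa mulr0.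
    by rewrite raddf0 add0r.
  have [t et] := lift_mx w fs; exists ((N *m t) 0 0).
    have : ideal_col I (M *m col_mx 0 t) by apply/MI; exists (col_mx 0 t).
    by rewrite Mw col_mxKu col_mxKd mxE mul0r raddf0 add0r.
  have -> : f ((N *m t) 0 0) = (map_mx f N *m w) 0 0 by rewrite -et -map_mxM [RHS]mxE.
  by rewrite -ew mxE eqxx mulr1n.
have [ys eys] : exists ys, map f ys = ys'.
  elim: (ys') => [|y zs [ws <-]]; first by exists [::].
  by have [y' <-] := fs y; exists (y' :: ws).
exists (a :: ys); split; first by split=> //; apply/(regmod_quot _ fq); rewrite eys.
move=> i; rewrite -memI' ys'I -eys rspan_quot //= ; split.
  move=> [t tP ft]; have /fK/principalE[r er] : f (i - t) = 0.
    by rewrite rmorphB ft subrr.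
  by exists r, t; split=> //; rewrite -(subrK t i) er.
move=> [r [t [_ tP ->]]]; exists t => //.
by rewrite rmorphD rmorphM fa mulr0 add0r.
Qed.
(** * Derivations and syzygies *)

(** Higher derivations of length [L].  A derivation is the component of degree
    [1] of one of length [1], and a higher derivation has length [L] for all
    [L]: this covers both kinds of families at once. *)
Record hs_derivation (A : comNzRingType) (L : nat) (D : nat -> A -> A) : Prop := {
  hsD : forall n a b, D n (a + b) = D n a + D n b;
  hs0 : forall a, D 0 a = a;
  hsM : forall n a b, (n <= L)%N ->
    D n (a * b) = \sum_(i < n.+1) D i a * D (n - i)%N b }.

(** A lift of [D] to a free module; for [L = 1] its component of degree [1] is
    a connection along the derivation [D 1]. *)
Record hs_connection (A : comNzRingType) (L : nat) (D : nat -> A -> A) u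
    (E : nat -> 'cV[A]_u -> 'cV[A]_u) : Prop := {
  hscD : forall n v w, E n (v + w) = E n v + E n w;
  hsc0 : forall v, E 0 v = v;
  hscZ : forall n a v, (n <= L)%N ->
    E n (a *: v) = \sum_(i < n.+1) D i a *: E (n - i)%N v }.

Definition hs_stable (A : comNzRingType) (L : nat) (D : nat -> A -> A) u
    (S : 'cV[A]_u -> Prop) : Prop :=
  exists2 E, hs_connection L D E &
    forall n, (n <= L)%N -> forall v, S v -> S (E n v).

Lemma sum_convolution (V : nmodType) (F : nat -> nat -> nat -> V) n :
  \sum_(i < n.+1) \sum_(j < i.+1) F j (i - j)%N (n - i)%N =
  \sum_(j < n.+1) \sum_(l < (n - j).+1) F j l (n - j - l)%N.
Proof.
transitivity (\sum_(i < n.+1) \sum_(j < n.+1 | (j < i.+1)%N) F j (i - j)%N (n - i)%N).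
  apply: eq_bigr => i _.
  by rewrite (big_ord_widen n.+1 (fun j => F j (i - j)%N (n - i)%N)).
rewrite (exchange_big_dep predT) //=; apply: eq_bigr => j _.
transitivity (\sum_(j <= i < n.+1) F j (i - j)%N (n - i)%N).
  by rewrite big_geq_mkord.
rewrite -[X in \sum_(X <= _ < _) _]add0n big_addn big_mkord.
rewrite subSn; last by rewrite -ltnS.
by apply: eq_bigr => l _; rewrite addnK addnC subnDA.
Qed.

Lemma hsc_zero (A : comNzRingType) L (D : nat -> A -> A) u
    (E : nat -> 'cV[A]_u -> 'cV[A]_u) n : hs_connection L D E -> E n 0 = 0.
Proof. by move=> cE; apply: (addIr (E n 0)); rewrite -(hscD cE) !add0r. Qed.

Lemma hsc_sum (A : comNzRingType) L (D : nat -> A -> A) u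
    (E : nat -> 'cV[A]_u -> 'cV[A]_u) n (I : finType) (F : I -> 'cV[A]_u) :
  hs_connection L D E -> E n (\sum_i F i) = \sum_i E n (F i).
Proof.
by move=> cE; apply: (big_morph (E n)); [exact: (hscD cE)|exact: hsc_zero cE].
Qed.

Lemma cV_sum_delta (A : comNzRingType) u (v : 'cV[A]_u) :
  v = \sum_k v k 0 *: delta_mx k 0.
Proof.
rewrite {1}[v]matrix_sum_delta; apply: eq_bigr => k _.
by rewrite big_ord1.
Qed.

(** A higher derivation lifts along a free cover of a stable module, so it acts
    on the module of syzygies: the image of each basis vector is chosen in the
    fibre over the element where it has to go. *)
Lemma hs_stable_mker (A : comNzRingType) L (D : nat -> A -> A) u g
    (M : 'M[A]_(u, g)) S :
  hs_derivation L D -> generates_mx M S -> hs_stable L D S ->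
  hs_stable L D (mker M).
Proof.
move=> dD MS [E cE ES].
have ex (kn : 'I_g * nat) : exists z : 'cV[A]_g,
    (kn.2 = 0%N -> z = delta_mx kn.1 0) /\
    ((kn.2 <= L)%N -> M *m z = E kn.2 (col kn.1 M)).
  case: kn => k [|n] /=.
    by exists (delta_mx k 0); split=> // _; rewrite (hsc0 cE) colE.
  have [nL|nL] := pselect (n.+1 <= L)%N; last by exists 0; split.
  have [z ez] : exists z, E n.+1 (col k M) = M *m z.
    by apply/MS; apply: ES => //; apply/MS; exists (delta_mx k 0); rewrite colE.
  by exists z; split.
have [y yP] := choice ex.
pose E' n (w : 'cV[A]_g) := \sum_k \sum_(i < n.+1) D i (w k 0) *: y (k, (n - i)%N).
have ME' n w : (n <= L)%N -> M *m E' n w = E n (M *m w).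
  move=> nL; rewrite [in RHS](cV_sum_delta w) !mulmx_sumr (hsc_sum _ _ cE).
  apply: eq_bigr => k _; rewrite mulmx_sumr -scalemxAr -colE (hscZ cE) //.
  apply: eq_bigr => i _; rewrite -scalemxAr (proj2 (yP _)) //=.
  by rewrite (leq_trans (leq_subr _ _)).
exists E'; last by move=> n nL w Mw; rewrite /mker ME' // Mw (hsc_zero n cE).
split=> [n v w|w|n a w nL].
- rewrite /E' -big_split /=; apply: eq_bigr => k _.
  rewrite -big_split /=; apply: eq_bigr => i _.
  by rewrite mxE (hsD dD) scalerDl.
- rewrite {2}[w]cV_sum_delta; apply: eq_bigr => k _.
  by rewrite big_ord1 (hs0 dD) (proj1 (yP _)).
transitivity (\sum_k \sum_(j < n.+1) \sum_(l < (n - j).+1)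
    D j a *: (D l (w k 0) *: y (k, (n - j - l)%N))).
  apply: eq_bigr => k _.
  rewrite -(sum_convolution (fun i j l => D i a *: (D j (w k 0) *: y (k, l)))).
  apply: eq_bigr => i _; rewrite mxE (hsM dD); last first.
    by apply: leq_trans nL; rewrite -ltnS.
  by rewrite scaler_suml; apply: eq_bigr => j _; rewrite scalerA.
rewrite exchange_big /=; apply: eq_bigr => j _; rewrite scaler_sumr.
by apply: eq_bigr => k _; rewrite scaler_sumr.
Qed.

(** In coordinates, [E n] differs from [D n] by a combination of values of the
    [D i] with [i < n], which an induction on [n] places in [J]. *)
Lemma hs_stable_entries (A : comNzRingType) L (D : nat -> A -> A) u
    (S : 'cV[A]_u -> Prop) (J : A -> Prop) n v i :
  ideal J -> hs_stable L D S -> incl S (entries_in J (n := u)) ->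
  (n <= L)%N -> S v -> J (D n (v i 0)).
Proof.
move=> iJ [E cE ES] SJ; elim/ltn_ind: n v i => n IH v t nL Sv.
have e : E n v t 0 =
    \sum_k \sum_(i < n) D i (v k 0) * E (n - i)%N (delta_mx k 0) t 0
      + D n (v t 0).
  rewrite {1}[v]cV_sum_delta (hsc_sum _ _ cE) summxE.
  under eq_bigr => k _ do
    rewrite (hscZ cE) // big_ord_recr /= subnn (hsc0 cE) mxE summxE.
  rewrite big_split /=; congr (_ + _).
    by apply: eq_bigr => k _; apply: eq_bigr => i _; rewrite mxE.
  rewrite (bigD1 t) //= !mxE !eqxx mulr1 big1 ?addr0 // => k /negbTE kt.
  by rewrite !mxE eq_sym kt mulr0.
have := SJ _ (ES n nL v Sv) t; rewrite e; apply: (idealDr iJ).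
apply: ideal_sum => // k _; apply: ideal_sum => // i _; apply: idealMl => //.
by apply: IH => //; apply: ltnW; apply: leq_trans nL.
Qed.

Definition family_mem (A : comNzRingType) (DD : derivation_family A) (L : nat)
    (D : nat -> A -> A) : Prop :=
  match DD with
  | inl ders => exists d,
      [/\ ders d, L = 1%N & D = fun n => if n is 0%N then id else d]
  | inr hders => exists2 D', hders D' & D = fun n => D' n
  end.

Lemma family_mem_hs (A : comNzRingType) (DD : derivation_family A) L D :
  family_mem DD L D -> hs_derivation L D.
Proof.
case: DD => [ders|hders] /=.
  move=> [d [_ -> ->]]; split=> // [[|n] a b //|[|[|n]] a b // _].
  - by rewrite raddfD.
  - by rewrite big_ord1.
  - by rewrite !big_ord_recl big_ord0 /= addr0 derM [b * _]mulrC.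
move=> [D' _ ->]; split=> [n a b|a|n a b _]; first exact: raddfD.
  exact: hder0.
exact: hderM.
Qed.

Lemma differentialE (A : comNzRingType) (DD : derivation_family A) (J : {pred A}) :
  differential DD J <-> forall L D, family_mem DD L D ->
    forall n, (n <= L)%N -> forall a, a \in J -> D n a \in J.
Proof.
case: DD => [ders|hders] /=; split.
- by move=> dJ _ _ [d [dd -> ->]] [|[|n]] // _ a; apply: dJ.
- move=> dJ d dd a; apply: (dJ 1%N (fun n => if n is 0%N then id else d) _ 1%N) => //.
  by exists d.
- by move=> dJ L _ [D' dD' ->] n _ a; apply: dJ.
- move=> dJ D dD n a; apply: (dJ n (fun n => D n) _ n) => //.
  by exists D.
Qed.

(** The coordinates of a stable submodule generate, together with [I], a
    differential ideal.  It is [I] when it is proper, by maximality. *)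
Lemma maximally_differential_entries (A : comNzRingType)
    (DD : derivation_family A) (I : idealr A) u (S : 'cV[A]_u -> Prop) :
  local A -> maximally_differential DD I ->
  (forall L D, family_mem DD L D -> hs_stable L D S) ->
  incl S (entries_in (@nonunit A) (n := u)) ->
  incl S (entries_in (fun a => a \in I) (n := u)).
Proof.
move=> lA [dI maxI] stS Sm v Sv i; apply: contrapT => vI.
pose J a := forall K, ideal K -> incl (fun a => a \in I) K ->
  incl S (entries_in K (n := u)) -> K a.
have IJ : incl (fun a => a \in I) J by move=> a Ia K _ IK _; apply: IK.
have SJ : incl S (entries_in J (n := u)) by move=> w Sw j K _ _ SK; apply: SK.
have iJ : ideal J.
  split=> [K iK _ _|a b Ja Jb K iK IK SK|r a Ja K iK IK SK].
  - exact: (ideal0 iK).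
  - by apply: (idealD iK); [apply: Ja|apply: Jb].
  - by apply: (idealM iK); apply: Ja.
have Jm : incl J (@nonunit A).
  move=> a; apply=> //; first exact: nonunit_ideal.
  move=> b Ib c cb; have := idealr1 I; rewrite -cb.
  by rewrite (idealMr _ Ib).
have dJ L D n : family_mem DD L D -> (n <= L)%N -> forall a, J a -> J (D n a).
  move=> DDD nL a Ja; have dD := family_mem_hs DDD.
  suff : forall m, (m <= L)%N -> J (D m a) by apply.
  apply: (Ja (fun a => forall m, (m <= L)%N -> J (D m a))).
  - split=> [m mL|b c Jb Jc m mL|r b Jb m mL].
    + have -> : D m 0 = 0 by apply: (addIr (D m 0)); rewrite -(hsD dD) !add0r.
      exact: ideal0.
    + by rewrite (hsD dD); exact (idealD iJ (Jb m mL) (Jc m mL)).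
    + rewrite (hsM dD) //; apply: (ideal_sum _ iJ) => j _; apply: (idealM iJ).
      by apply: Jb; apply: leq_trans mL; apply: leq_subr.
  - move=> b Ib m mL; apply: IJ.
    by apply: (proj1 (differentialE DD I) dI L D).
  - move=> w Sw j m mL; apply: (hs_stable_entries _ iJ (stS _ _ DDD)) => //.
have [|J' J'E] := idealr_ex iJ; first by move=> /Jm; apply: (prime1 (nonunit_prime lA)).
apply: (maxI J'); last first.
  by apply/differentialE => L D DDD n nL a /J'E Ja; apply/J'E; apply: (dJ L).
split; first by move=> a /IJ/J'E.
by exists (v i 0); [apply/J'E; apply: SJ|apply/negP].
Qed.

(** Stability passes from each module of syzygies to the next one, so the
    matrices of all minimal resolutions have their entries in [I]. *)
Lemma fres_differential (A : comNzRingType) (DD : derivation_family A)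
    (I : idealr A) p u (S : 'cV[A]_u -> Prop) :
  local A -> maximally_differential DD I ->
  (forall L D, family_mem DD L D -> hs_stable L D S) ->
  fres (@nonunit A) p S -> fres (fun a => a \in I) p S.
Proof.
move=> lA mI; elim: p u S => [|p IH] u S //= stS res g M Mmin.
have [MS Mm] := Mmin; have [_ kres] := res g M Mmin.
have stM L D : family_mem DD L D -> hs_stable L D (mker M).
  by move=> DDD; apply: hs_stable_mker (family_mem_hs DDD) MS (stS _ _ DDD).
by split; [apply: maximally_differential_entries mI stM Mm|apply: IH].
Qed.

Lemma hs_stable_ideal (A : comNzRingType) L (D : nat -> A -> A) (I : A -> Prop) :
  hs_derivation L D -> (forall n, (n <= L)%N -> forall a, I a -> I (D n a)) ->
  hs_stable L D (ideal_col I).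
Proof.
move=> dD DI; exists (fun n v => map_mx (D n) v); last first.
  by move=> n nL v; rewrite /ideal_col mxE; apply: DI.
split=> [n v w|v|n a v nL]; apply/matrixP => i j; rewrite ?mxE.
- exact: (hsD dD).
- exact: (hs0 dD).
by rewrite summxE (hsM dD) //; apply: eq_bigr => k _; rewrite !mxE.
Qed.

(** * Regular local rings *)

Lemma idealr_ideal (A : comNzRingType) (I : idealr A) : ideal (fun a => a \in I).
Proof.
split; [exact: rpred0|by move=> a b; apply: rpredD|].
by move=> r a; apply: idealMr.
Qed.

Lemma idealr_proper (A : comNzRingType) (I : idealr A) : ~ (1 \in I).
Proof. by rewrite idealr1. Qed.

Lemma noetherian_noeth (A : comNzRingType) : noetherian A -> noeth A.
Proof.
move=> nA J iJ; have [J1|J1] := pselect (J 1).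
  exists [:: 1] => a; split=> [_|_]; last by have := idealM iJ a J1; rewrite mulr1.
  by exists a, 0; rewrite /= addr0 -[a *: _]/(a * 1) mulr1.
have [I IJ] := idealr_ex iJ J1; have [xs xsI] := nA I.
by exists xs => a; rewrite -IJ xsI in_gen_idealE.
Qed.

Lemma unique_maximal_nonunit (A : comNzRingType) (M : idealr A) :
  noeth A -> unique_maximal_ideal M -> forall a, nonunit a <-> a \in M.
Proof.
move=> nA [maxM uniqM] a; split=> [na|Ma]; last first.
  exact: proper_nonunit (idealr_ideal M) (@idealr_proper _ M) _ Ma.
have [||K [iK K1 Ka] Kmax] := @noeth_max A (fun K => [/\ ideal K, ~ K 1 & K a]) nA.
- by move=> K [].
- exists (principal a); split; first exact: principal_ideal.
    by move=> /principalE[r /esym]; apply: na.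
  by apply/principalE; exists 1; rewrite mul1r.
have [N NK] := idealr_ex iK K1.
have maxN : maximal_ideal N.
  move=> J [NJ [x Jx /negP Nx]]; apply: Nx; apply/NK.
  apply: (Kmax (fun b => b \in J)) => //.
    split; [exact: idealr_ideal|exact: idealr_proper|].
    by apply/NJ/NK.
  by move=> b /NK/NJ.
by rewrite -(uniqM N maxN); apply/NK.
Qed.

Lemma has_prime_chainE (A : comNzRingType) n :
  has_prime_chain A n -> exists P, @prime_chain A n P.
Proof.
move=> [P ltP]; exists (fun i a => a \in P (inord i)); split=> i lin.
  split; [exact: idealr_ideal|exact: idealr_proper|].
  by move=> a b; rewrite prime_idealrM => /orP.
have [|le [x xP xNP]] := ltP (inord i) (inord i.+1).
  by rewrite !inordK // ltnW.
by split=> // le'; move/negP: xNP; apply; apply: le'.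
Qed.

Lemma regular_local_fres (A : comNzRingType) : regular_local A ->
  [/\ noeth A, local A & exists p, forall u (S : 'cV[A]_u -> Prop),
    submod S -> fres (@nonunit A) p S].
Proof.
move=> [/noetherian_noeth nA [M [uM [xs [[/has_prime_chainE[P cP] _] xsM]]]]].
have nuE := unique_maximal_nonunit nA uM.
have lA : local A.
  by move=> a b /nuE Ma /nuE Mb; apply/nuE; apply: rpredD.
have xsm (a : A) : nonunit a <-> rspan A xs a by rewrite nuE xsM in_gen_idealE.
have [xsr _] := regular_local_gens nA lA erefl xsm cP.
by split=> //; exists (size xs).+1 => u S; apply: regular_fres xsr.
Qed.

Theorem theorem5 (A : comNzRingType) (hA : regular_local A)
    (DD : derivation_family A) (I : idealr A)
    (hI : maximally_differential DD I) :
  (exists xs : seq A, regular_sequence xs /\ generates xs I) /\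
  complete_intersection {ideal_quot I}.
Proof.
have [nA lA [p resA]] := regular_local_fres hA.
have iI := idealr_ideal I; have I1 := @idealr_proper _ I.
have Im := proper_nonunit iI I1; have sI := ideal_col_submod iI.
have res : fres (fun a => a \in I) p (ideal_col (fun a => a \in I)).
  apply: (fres_differential lA hI _ (resA _ _ sI)) => L D DDD.
  apply: (hs_stable_ideal (family_mem_hs DDD)) => n nL a.
  by apply: (proj1 (differentialE DD I) (proj1 hI) L D).
have [g [M [MI _]]] := noeth_mingen nA sI.
have [xs [xsr xsI]] := fres_regular_sequence nA lA iI Im (leqnn g) MI res.
have xs_gen : generates xs I by move=> a; rewrite xsI in_gen_idealE.
have xs_reg : regular_sequence xs by apply: regmod_regular => // /xsI.
split; first by exists xs.
exists A, xs, (\pi_{ideal_quot I})%qT; split=> // [b|s].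
  by exists (repr b); apply: reprK.
rewrite -xs_gen -(rmorph0 (\pi_{ideal_quot I})%qT) -[s in s \in I]subr0.
by rewrite Quotient.idealrBE; split=> /eqP.
Qed.
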